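(* Let $n\geq 2$ and let $X$ be a germ at $0\in\mathbb{C}^n$ of holomorphic vector field. Suppose that $\mathcal{M}(X)=\mathbb{C}$, that is, $X$ has no non-constant meromorphic first integral. Then $C(X)$ is a finite dimensional Lie algebra of dimension $r(X)$. In particular, $d(X)=r(X)$.
   Context: $\mathcal{X}_n$ is the set of germs at $0\in\mathbb{C}^n$ of holomorphic vector fields and $\mathcal{M}_n$ the field of germs at $0\in\mathbb{C}^n$ of meromorphic functions. For $X\in\mathcal{X}_n$: $C(X)=\{Y\in\mathcal{X}_n\mid[X,Y]=0\}$ (a complex Lie algebra under the Lie bracket); $d(X)=\dim_{\mathbb{C}}C(X)$; $r(X)$ is the maximal $r$ such that there exist $Y_1,\dots,Y_r\in C(X)$ with $Y_1\wedge\dots\wedge Y_r\not\equiv0$; $\mathcal{M}(X)=\{f\in\mathcal{M}_n\mid X(f)=0\}$. *)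

(* Defs.v *)
From HB Require Import structures.
From mathcomp Require Import all_boot all_order all_algebra.
From mathcomp Require Export complex.
From mathcomp Require Import all_classical all_reals all_analysis.

Set Implicit Arguments.
Unset Strict Implicit.
Unset Printing Implicit Defensive.

Import GRing.Theory Num.Theory.
Import numFieldNormedType.Exports.

Local Open Scope classical_set_scope.
Local Open Scope ring_scope.

(* A germ at 0 in K^n is handled through a representative, a total function   *)
(* on K^n whose values away from 0 are irrelevant: two representatives define *)
(* the same germ when they agree near 0, and every notion below depends on    *)
(* representatives only through their germs.  The field K is meant to be      *)
(* R[i] for R : realType; differentiability over K is then complex Frechet    *)
(* differentiability, so that holomorphic0 says: holomorphic on some          *)
(* neighbourhood of 0.                                                        *)

Section Germs.
Context {K : numFieldType} {n : nat}.

Definition holomorphic0 {V : normedModType K} (f : 'rV[K]_n -> V) : Prop :=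
  \forall z \near (0 : 'rV[K]_n), differentiable f z.

Definition vfield : set ('rV[K]_n -> 'rV[K]_n) := [set X | holomorphic0 X].

(* [X, Y] = X(Y) - Y(X), each field acting on the components of the other.    *)
Definition lie_bracket (X Y : 'rV[K]_n -> 'rV[K]_n) : 'rV[K]_n -> 'rV[K]_n :=
  fun z => 'D_(X z) Y z - 'D_(Y z) X z.

Definition centralizer (X : 'rV[K]_n -> 'rV[K]_n) :
    set ('rV[K]_n -> 'rV[K]_n) :=
  [set Y | vfield Y /\ \forall z \near (0 : 'rV[K]_n), lie_bracket X Y z = 0].

Definition lie_subalgebra (V : set ('rV[K]_n -> 'rV[K]_n)) : Prop :=
  [/\ V `<=` vfield,
      V (fun _ => 0),
      forall (a : K) Y Z, V Y -> V Z -> V (fun z => a *: Y z + Z z) &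
      forall Y Z, V Y -> V Z -> V (lie_bracket Y Z)].

(* Y is a basis, as a family of germs, of the K-vector space of germs V.      *)
Definition germ_basis (V : set ('rV[K]_n -> 'rV[K]_n)) (d : nat)
    (Y : 'I_d -> 'rV[K]_n -> 'rV[K]_n) : Prop :=
  [/\ forall i, V (Y i),
      forall a : 'I_d -> K,
        (\forall z \near (0 : 'rV[K]_n), \sum_i a i *: Y i z = 0) -> forall i, a i = 0 &
      forall Z, V Z -> exists a : 'I_d -> K,
        \forall z \near (0 : 'rV[K]_n), Z z = \sum_i a i *: Y i z].

Definition has_dim (V : set ('rV[K]_n -> 'rV[K]_n)) (d : nat) : Prop :=
  exists Y : 'I_d -> 'rV[K]_n -> 'rV[K]_n, germ_basis V Y.

Definition finite_dim (V : set ('rV[K]_n -> 'rV[K]_n)) : Prop :=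
  exists d, has_dim V d.

(* Only meaningful when finite_dim V holds.                                   *)
Definition dimension (V : set ('rV[K]_n -> 'rV[K]_n)) : nat :=
  get [set d | has_dim V d].

(* Y_1 /\ ... /\ Y_r as an alternating tensor: its component along            *)
(* (j 0, ..., j (r-1)) is dz_(j 0) /\ ... /\ dz_(j (r-1)) evaluated on        *)
(* (Y_1, ..., Y_r).                                                           *)
Definition wedge (r : nat) (Y : 'I_r -> 'rV[K]_n -> 'rV[K]_n) (z : 'rV[K]_n) :
    {ffun {ffun 'I_r -> 'I_n} -> K} :=
  [ffun j : {ffun 'I_r -> 'I_n} => \det (\matrix_(i, k) Y i z 0 (j k))].

Definition wedge_family (X : 'rV[K]_n -> 'rV[K]_n) (r : nat) : Prop :=
  exists2 Y : 'I_r -> 'rV[K]_n -> 'rV[K]_n,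
    forall i, centralizer X (Y i) & ~ (\forall z \near (0 : 'rV[K]_n), wedge Y z = 0).

(* The maximal r exists: 0 qualifies, as the empty wedge is 1, and r > n does *)
(* not.                                                                       *)
Definition wedge_rank (X : 'rV[K]_n -> 'rV[K]_n) : nat :=
  get [set r | wedge_family X r /\ forall s, wedge_family X s -> (s <= r)%N].

(* A germ of meromorphic function is a quotient of holomorphic germs whose    *)
(* denominator is not the zero germ.                                          *)
Record meromorphic := Meromorphic {
  mer_num : 'rV[K]_n -> K^o;
  mer_den : 'rV[K]_n -> K^o;
  mer_num_holo : holomorphic0 mer_num;
  mer_den_holo : holomorphic0 mer_den;
  mer_den_neq0 : ~ (\forall z \near (0 : 'rV[K]_n), mer_den z = 0) }.

Definition mer_val (f : meromorphic) : 'rV[K]_n -> K^o :=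
  fun z => mer_num f z / mer_den f z.

(* An identity between meromorphic germs holds when it holds near 0 off the   *)
(* zero set of the denominators, a dense open set.                            *)
Definition first_integrals (X : 'rV[K]_n -> 'rV[K]_n) : set meromorphic :=
  [set f | \forall z \near (0 : 'rV[K]_n), mer_den f z != 0 -> 'D_(X z) (mer_val f) z = 0].

Definition mer_constants : set meromorphic :=
  [set f | exists c : K, \forall z \near (0 : 'rV[K]_n), mer_den f z != 0 -> mer_val f z = c].

End Germs.

(* Main.v *)
Require Import Defs.
From HB Require Import structures.
From mathcomp Require Import all_boot all_order all_algebra fingroup perm.
From mathcomp Require Import complex.
From mathcomp Require Import all_classical all_reals all_analysis.
From mathcomp Require Import ring lra.
Set Implicit Arguments.
Unset Strict Implicit.
Unset Printing Implicit Defensive.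
Import Order.TTheory GRing.Theory Num.Theory.
Import numFieldNormedType.Exports.
Local Open Scope classical_set_scope.
Local Open Scope ring_scope.

(* Let r = wedge_rank X, let Y_1, ..., Y_r in C(X) have a nonzero wedge, and  *)
(* let D be an r x r minor of (Y_1, ..., Y_r) which is not the zero germ.  By *)
(* maximality of r every Z in C(X) is, where D does not vanish, a combination *)
(* Z = sum_i f_i Y_i with f_i = N_i / D meromorphic by Cramer's rule, and     *)
(* 0 = [X, Z] = sum_i X(f_i) Y_i makes every f_i a first integral, hence a    *)
(* constant c_i.  So D (Z - sum_i c_i Y_i) = 0, and Z = sum_i c_i Y_i since   *)
(* germs of holomorphic functions form an integral domain.                    *)
(*                                                                            *)
(* Holomorphic means here complex differentiable near 0, so what is needed of *)
(* complex analysis (stability of C(X) under brackets and the integral domain *)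
(* property) has to come from Cauchy's formula:                               *)
(*   f'(a) = kappa^-1 * \oint f(a + s z) z^-2 dz / s                          *)
(* over the square of vertices +-1 +-i, which follows from Goursat's lemma on *)
(* the four trapezoids between two concentric squares.  Only f'(centre) and   *)
(* kappa != 0 are used.  The formula bounds derivatives, hence gives Taylor   *)
(* remainders uniform in the base point, so that it can be differentiated     *)
(* under the integral: 'D_h 'D_v f is the Cauchy integral in direction v of   *)
(* 'D_h f, that is, 'D_v 'D_h f.                                              *)

(** Over the field of meromorphic germs, Cramer's rule writes every member of C(X) on r members with
    nonzero wedge, and the coefficients are killed by X. If X kills only constants, the coefficients
    are complex numbers, and the r members form a basis of C(X) over the complex numbers.

    [cramer_span] (maximality of r makes the bordered minors vanish), [derive_cramer] (the
    coefficients are first integrals) and [centralizer_span] (they are constants) carry this;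
    [centralizer_has_dim] adds linear independence.

    Two analytic facts support the algebra: [germ_domain], which allows division by the minor, and
    [derive_symmetric], the symmetry of second derivatives behind [centralizer_bracket]. Both
    descend from [goursat] through [sqint_scale], [cauchy_derivative] and [cauchy_directional]. The
    uniform remainder [taylor_uniform] justifies differentiating Cauchy's integral, and
    [vanish_spread0] pushes zeros from a small disc to a disc of controlled size. *)

Section ComplexNorm.
Context {R : realType}.
Implicit Types x y : R[i].

(** The norm of a space over [R[i]] is itself an element of [R[i]]; its real part is taken so that
    all estimates live in the ordered field [R]. *)
Definition nrm {V : normedZmodType R[i]} (v : V) : R := complex.Re `|v|.

Lemma nrmE (V : normedZmodType R[i]) (v : V) : `|v| = ((nrm v)%:C)%C.
Proof.
by rewrite /nrm; case: `|v| (ger0_Im (normr_ge0 v)) => a b /= ->.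
Qed.

Lemma nrm_ge0 (V : normedZmodType R[i]) (v : V) : 0 <= nrm v.
Proof. by have := normr_ge0 v; rewrite nrmE ler0c. Qed.

Lemma nrm0 (V : normedZmodType R[i]) : nrm (0 : V) = 0.
Proof. by rewrite /nrm normr0. Qed.

Lemma nrm_eq0 (V : normedZmodType R[i]) (v : V) : nrm v = 0 -> v = 0.
Proof. by move=> v0; apply/normr0_eq0; rewrite nrmE v0. Qed.

Lemma nrmN (V : normedZmodType R[i]) (v : V) : nrm (- v) = nrm v.
Proof. by rewrite /nrm normrN. Qed.

Lemma nrmD (V : normedZmodType R[i]) (v w : V) : nrm (v + w) <= nrm v + nrm w.
Proof. by have := ler_normD v w; rewrite !nrmE -rmorphD lecR. Qed.

Lemma nrmB (V : normedZmodType R[i]) (v w : V) : nrm (v - w) <= nrm v + nrm w.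
Proof. by rewrite -(nrmN w) nrmD. Qed.

Lemma nrm_sub (V : normedZmodType R[i]) (v w : V) : nrm v - nrm w <= nrm (v - w).
Proof. by rewrite lerBlDr -{1}(subrK w v) nrmD. Qed.

Lemma nrmC (V : normedZmodType R[i]) (v w : V) : nrm (v - w) = nrm (w - v).
Proof. by rewrite -nrmN opprB. Qed.

Lemma nrmZ (V : normedModType R[i]) (a : R[i]) (v : V) :
  nrm (a *: v) = nrm a * nrm v.
Proof.
by apply: (@complexI R); rewrite rmorphM /= -!nrmE normrZ.
Qed.

Lemma nrmM x y : nrm (x * y) = nrm x * nrm y.
Proof. by apply: (@complexI R); rewrite rmorphM /= -!nrmE normrM. Qed.

Lemma nrmV x : nrm x^-1 = (nrm x)^-1.
Proof. by apply: (@complexI R); rewrite fmorphV /= -!nrmE normfV. Qed.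

Lemma nrmX x n : nrm (x ^+ n) = nrm x ^+ n.
Proof. by apply: (@complexI R); rewrite rmorphXn /= -!nrmE normrX. Qed.

Lemma nrm_gt0 (V : normedZmodType R[i]) (v : V) : v != 0 -> 0 < nrm v.
Proof.
by move=> v0; rewrite lt_neqAle nrm_ge0 andbT eq_sym; apply: contra v0 => /eqP/nrm_eq0->.
Qed.

Lemma nrm_real (a : R) : nrm (a%:C)%C = `|a|.
Proof. by rewrite /nrm normc_def /= expr0n addr0 sqrtr_sqr. Qed.

Lemma nrm_i : nrm ('i%C : R[i]) = 1.
Proof. by rewrite /nrm normc_def /= expr0n add0r expr1n sqrtr1. Qed.

Lemma nrm_nat n : nrm (n%:R : R[i]) = n%:R.
Proof. by rewrite -(rmorph_nat (real_complex R)) nrm_real normr_nat. Qed.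

Lemma Re_le_nrm x : `|complex.Re x| <= nrm x.
Proof.
rewrite /nrm normc_def /= -sqrtr_sqr ler_wsqrtr //.
by rewrite lerDl sqr_ge0.
Qed.

Lemma Im_le_nrm x : `|complex.Im x| <= nrm x.
Proof.
rewrite /nrm normc_def /= -sqrtr_sqr ler_wsqrtr //.
by rewrite lerDr sqr_ge0.
Qed.

Lemma nrm_le_ReIm x : nrm x <= `|complex.Re x| + `|complex.Im x|.
Proof.
rewrite {1}(complexE x) (le_trans (nrmD _ _)) // nrmM nrm_i mul1r.
by rewrite !nrm_real.
Qed.

(** The form in which Goursat's lemma, Cauchy's formula and the spreading of zeros conclude: a fixed
    quantity is bounded by a constant times an arbitrary e. *)
Lemma nrm_small_eq0 (V : normedZmodType R[i]) (v : V) (c : R) :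
  (forall e : R, 0 < e -> nrm v <= c * e) -> v = 0.
Proof.
move=> h; apply: nrm_eq0; apply/eqP; rewrite eq_le nrm_ge0 andbT leNgt.
apply/negP => v0.
(* A positive majorant of [c], whose sign is unknown; e = [nrm v / (2 k)] then gives
   [nrm v <= nrm v / 2]. *)
pose k := `|c| + 1; have k0 : 0 < k by rewrite ltr_wpDl.
have := h (nrm v / k / 2).
have e0 : 0 < nrm v / k / 2 by rewrite !divr_gt0.
move=> /(_ e0); apply/negP; rewrite -ltNge.
have : c * (nrm v / k / 2) <= k * (nrm v / k / 2).
  by rewrite ler_pM2r // (le_trans (ler_norm c)) // lerDl.
move=> /le_lt_trans; apply.
have -> : k * (nrm v / k / 2) = nrm v / 2 by field; rewrite gt_eqF.
by lra.
Qed.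

End ComplexNorm.

(** * Integrals of complex-valued functions *)

Section ComplexIntegral.
Context {R : realType}.
Local Notation C := R[i].
Local Notation mu := (@lebesgue_measure R).
Implicit Types (f g : R -> C) (a b c : R).

(** Continuity is spelled out because the variable is normed over [R] and the values over [R[i]]. *)
Definition ccont f (x : R) := forall e : R, 0 < e -> exists2 d : R, 0 < d &
  forall y, `|y - x| < d -> nrm (f y - f x) <= e.

Definition ccont_on a b f := forall x, a <= x <= b -> ccont f x.

Definition cint a b f : C :=
  Complex (\int[mu]_(x in `[a, b]) complex.Re (f x))
          (\int[mu]_(x in `[a, b]) complex.Im (f x)).

Lemma ReD (x y : C) : complex.Re (x + y) = complex.Re x + complex.Re y.
Proof. by case: x; case: y. Qed.
Lemma ImD (x y : C) : complex.Im (x + y) = complex.Im x + complex.Im y.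
Proof. by case: x; case: y. Qed.
(** Stated as a sum of two multiples so that additivity and homogeneity of the real integral apply
    directly in [cintZ]. *)
Lemma ReM (x y : C) : complex.Re (x * y) =
  complex.Re x * complex.Re y + - complex.Im x * complex.Im y.
Proof. by case: x => a b; case: y => c d /=; rewrite mulNr. Qed.
Lemma ImM (x y : C) : complex.Im (x * y) =
  complex.Re x * complex.Im y + complex.Im x * complex.Re y.
Proof. by case: x => a b; case: y => c d. Qed.
Lemma ReB (x y : C) : complex.Re (x - y) = complex.Re x - complex.Re y.
Proof. by case: x; case: y. Qed.
Lemma ImB (x y : C) : complex.Im (x - y) = complex.Im x - complex.Im y.
Proof. by case: x; case: y. Qed.

Lemma integrable_part (p : C -> R) a b f :
  (forall x y, p (x - y) = p x - p y) -> (forall x, `|p x| <= nrm x) ->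
  ccont_on a b f -> mu.-integrable `[a, b] (EFin \o (p \o f)).
Proof.
move=> pB pn cf; apply: continuous_compact_integrable; first exact: segment_compact.
apply: continuous_in_subspaceT => x; rewrite inE /= in_itv /= => /cf fx.
apply/cvgrPdist_le => e e0; have [d d0 fd] := fx e e0.
apply/nbhs_ballP; exists d => //= y; rewrite /ball /= distrC => /fd.
by rewrite distrC -pB; apply: le_trans.
Qed.

Lemma integrable_Re a b f : ccont_on a b f ->
  mu.-integrable `[a, b] (EFin \o (fun x => complex.Re (f x))).
Proof. exact: (integrable_part ReB Re_le_nrm). Qed.

Lemma integrable_Im a b f : ccont_on a b f ->
  mu.-integrable `[a, b] (EFin \o (fun x => complex.Im (f x))).
Proof. exact: (integrable_part ImB Im_le_nrm). Qed.

Lemma ccontD f g x : ccont f x -> ccont g x -> ccont (fun x => f x + g x) x.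
Proof.
move=> cf cg e e0; have e2 : 0 < e / 2 by rewrite divr_gt0.
have [d d0 fd] := cf _ e2; have [d' d'0 gd] := cg _ e2.
exists (Num.min d d'); first by rewrite lt_min d0.
move=> y; rewrite lt_min => /andP[/fd h1 /gd h2].
have -> : f y + g y - (f x + g x) = (f y - f x) + (g y - g x) by ring.
by rewrite (le_trans (nrmD _ _)) //; lra.
Qed.

Lemma ccontM f g x : ccont f x -> ccont g x -> ccont (fun x => f x * g x) x.
Proof.
move=> cf cg e e0.
pose M := nrm (f x) + nrm (g x) + 1.
have M1 : 1 <= M by rewrite lerDr addr_ge0 ?nrm_ge0.
have e2 : 0 < Num.min 1 (e / 2 / M) by rewrite lt_min ltr01 !divr_gt0 //; lra.
have [d d0 fd] := cf _ e2; have [d' d'0 gd] := cg _ e2.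
exists (Num.min d d'); first by rewrite lt_min d0.
move=> y; rewrite lt_min => /andP[/fd + /gd].
rewrite !le_min => /andP[h1 h1'] /andP[h2 h2'].
have -> : f y * g y - f x * g x = (f y - f x) * g x + ((f y - f x) + f x) * (g y - g x) by ring.
rewrite (le_trans (nrmD _ _)) // !nrmM.
have M0 : 0 < M by lra.
rewrite ler_pdivlMr // in h1'; rewrite ler_pdivlMr // in h2'.
have := nrmD (f y - f x) (f x).
have := nrm_ge0 (f x); have := nrm_ge0 (g x).
have := nrm_ge0 (f y - f x); have := nrm_ge0 (g y - g x).
have := nrm_ge0 (f y - f x + f x).
rewrite /M in h1' h2'.
by nra.
Qed.

Lemma ccont_cst (k : C) x : ccont (fun=> k) x.
Proof. by move=> e e0; exists 1 => // y _; rewrite subrr nrm0 ltW. Qed.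

Lemma ccont_id x : ccont (fun x => (x%:C)%C) x.
Proof. by move=> e e0; exists e => // y ye; rewrite -rmorphB nrm_real ltW. Qed.

Lemma eq_cint a b f g : (forall x, a <= x <= b -> f x = g x) ->
  cint a b f = cint a b g.
Proof.
move=> fg; rewrite /cint; congr Complex; apply: eq_Rintegral => x;
  by rewrite inE /= in_itv /= => /fg ->.
Qed.

Lemma cintD a b f g : ccont_on a b f -> ccont_on a b g ->
  cint a b (fun x => f x + g x) = cint a b f + cint a b g.
Proof.
move=> cf cg; rewrite /cint; apply/eqP; rewrite eq_complex /=; apply/andP; split; apply/eqP.
- rewrite -RintegralD //; [|exact: integrable_Re|exact: integrable_Re].
  by apply: eq_Rintegral => x _; rewrite ReD.
- rewrite -RintegralD //; [|exact: integrable_Im|exact: integrable_Im].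
  by apply: eq_Rintegral => x _; rewrite ImD.
Qed.

Lemma cintZ a b (k : C) f : ccont_on a b f ->
  cint a b (fun x => k * f x) = k * cint a b f.
Proof.
move=> cf; have iR := integrable_Re cf; have iI := integrable_Im cf.
have iZ (r : R) (h : R -> R) : mu.-integrable `[a, b] (EFin \o h) ->
   mu.-integrable `[a, b] (EFin \o (fun x => r * h x)).
  by move=> ih; apply: eq_integrable (integrableZl _ r ih).
rewrite /cint; apply/eqP; rewrite eq_complex ReM ImM /=; apply/andP; split; apply/eqP.
- rewrite -!RintegralZl // -RintegralD //; [|exact: iZ|exact: iZ].
  by apply: eq_Rintegral => x _; rewrite ReM.
- rewrite -!RintegralZl // -RintegralD //; [|exact: iZ|exact: iZ].
  by apply: eq_Rintegral => x _; rewrite ImM.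
Qed.

Lemma Rint_bound a b (h : R -> R) (M : R) : a <= b ->
  mu.-integrable `[a, b] (EFin \o h) ->
  (forall x, a <= x <= b -> `|h x| <= M) ->
  `|\int[mu]_(x in `[a, b]) h x| <= M * (b - a).
Proof.
move=> ab ih hM.
have H (h' : R -> R) : mu.-integrable `[a, b] (EFin \o h') ->
  (forall x, a <= x <= b -> h' x <= M) -> \int[mu]_(x in `[a, b]) h' x <= M * (b - a).
  move=> ih' h'M.
  have -> : M * (b - a) = \int[mu]_(x in `[a, b]) M.
    rewrite Rintegral_cst //=; congr (_ * _).
    by rewrite lebesgue_measure_itv /= lte_fin; case: ltP => // ba; have -> : a = b; [lra|rewrite subrr].
  apply: le_Rintegral => //.
  apply: continuous_compact_integrable; first exact: segment_compact.
  by apply: continuous_subspaceT => x; exact: cvg_cst.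
rewrite ler_norml; apply/andP; split.
  rewrite lerNl -mulN1r -RintegralZl //; apply: H.
    by apply: eq_integrable (integrableZl _ (-1) ih).
  by move=> x /hM; rewrite ler_norml => /andP[? _]; lra.
by apply: H => // x /hM; rewrite ler_norml => /andP[].
Qed.

(** The factor 2 comes from bounding the real and imaginary parts separately; a sharp constant would
    bring nothing to the estimates below. *)
Lemma cint_bound a b f (M : R) : a <= b -> ccont_on a b f ->
  (forall x, a <= x <= b -> nrm (f x) <= M) -> nrm (cint a b f) <= 2 * M * (b - a).
Proof.
move=> ab cf fM; rewrite (le_trans (nrm_le_ReIm _)) //=.
have -> : 2 * M * (b - a) = M * (b - a) + M * (b - a) by ring.
apply: lerD; apply: Rint_bound => //.
- exact: integrable_Re.
- by move=> x /fM; apply: le_trans; exact: Re_le_nrm.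
- exact: integrable_Im.
- by move=> x /fM; apply: le_trans; exact: Im_le_nrm.
Qed.

Lemma cint_split a c b f : a <= c -> c <= b -> ccont_on a b f ->
  cint a b f = cint a c f + cint c b f.
Proof.
move=> ac cb cf.
have H (h : R -> R) : mu.-integrable `[a, b] (EFin \o h) ->
  \int[mu]_(x in `[a, b]) h x = \int[mu]_(x in `[a, c]) h x + \int[mu]_(x in `[c, b]) h x.
  move=> ih; have := Rintegral_itvB ih (x := c).
  rewrite !bnd_simp => /(_ ac cb) /eqP; rewrite subr_eq => /eqP ->; rewrite addrC; congr (_ + _).
  rewrite Rintegral_itv_obnd_cbnd //; apply: integrableS ih => //.
  by apply: subset_itvr; rewrite bnd_simp.
rewrite /cint; apply/eqP; rewrite eq_complex /=; apply/andP; split; apply/eqP; apply: H.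
- exact: integrable_Re.
- exact: integrable_Im.
Qed.

Lemma Rint_cst a b (k : R) : a <= b -> \int[mu]_(x in `[a, b]) k = k * (b - a).
Proof.
move=> ab; rewrite Rintegral_cst //=; congr (_ * _).
by rewrite lebesgue_measure_itv /= lte_fin; case: ltP => // ba; have -> : a = b; [lra|rewrite subrr].
Qed.

Lemma cint_cst a b (k : C) : a <= b -> cint a b (fun=> k) = k * ((b - a)%:C)%C.
Proof.
move=> ab; rewrite /cint !Rint_cst //; case: k => u v /=.
by apply/eqP; rewrite eq_complex /=; apply/andP; split; apply/eqP; ring.
Qed.

Lemma cint_id a b : a <= b ->
  cint a b (fun x => (x%:C)%C) = (((b ^+ 2 - a ^+ 2) / 2)%:C)%C.
Proof.
(* The fundamental theorem of calculus is applied on a proper segment, so the one-point segment is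
   settled apart. *)
rewrite le_eqVlt => /predU1P[<-|ab].
  rewrite /cint set_itv1 !Rintegral_set1; apply/eqP; rewrite eq_complex /= !eqxx andbT.
  by rewrite subrr mul0r.
rewrite /cint Rint_cst ?ltW //= mul0r; congr Complex.
rewrite /Rintegral.
rewrite (@continuous_FTC2 _ id (fun x => x ^+ 2 / 2) a b) //=.
- by rewrite mulrBl.
- by apply: continuous_subspaceT => x; exact: cvg_id.
- have dd x : derivable (fun x : R => x ^+ 2 / 2 : R^o) x 1.
    by apply: ex_derive.
  have cc x : {for x, continuous (fun x : R => x ^+ 2 / 2 : R^o)}.
    by apply/differentiable_continuous/derivable1_diffP.
  split; first by move=> x _.
    by apply: cvg_at_right_filter; exact: cc.
  by apply: cvg_at_left_filter; exact: cc.
- move=> x _; rewrite derive1E.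
  rewrite (_ : (fun x : R => x ^+ 2 / 2) = (fun x : R => x ^+ 2) * cst (2^-1)); last by apply/funext.
  rewrite derive_val /=  /GRing.scale /=.
  by field.
Qed.

Lemma cint_affine a b (u v : C) : a <= b ->
  cint a b (fun x => u + v * (x%:C)%C) =
  u * ((b - a)%:C)%C + v * (((b ^+ 2 - a ^+ 2) / 2)%:C)%C.
Proof.
move=> ab; rewrite cintD; last 2 first.
- by move=> x _; exact: ccont_cst.
- by move=> x _; apply: ccontM; [exact: ccont_cst|exact: ccont_id].
by rewrite cint_cst // cintZ ?cint_id // => x _; exact: ccont_id.
Qed.

End ComplexIntegral.

(** * Goursat's lemma *)

Section Goursat.
Context {R : realType}.
Local Notation C := R[i].

Lemma exists_half_expn_lt (d : R) : 0 < d -> exists n : nat, (1 / 2) ^+ n < d.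
Proof.
move=> d0; exists (Num.bound d^-1).
have := @upper_nthrootP R d^-1 (Num.bound d^-1) (leqnn _).
rewrite expr_div_n expr1n mul1r => h.
by rewrite invf_plt // posrE exprn_gt0.
Qed.

Definition in_unit_square (a c l : R) :=
  [/\ 0 < l, 0 <= a, a + l <= 1, 0 <= c & c + l <= 1].

(** Bisection: if [P] failed on the unit square, it would fail on one quarter, then on a quarter of
    that, and so on. These nested squares share a point, and the local hypothesis at that point
    contradicts the failure on a small enough square. *)
Lemma square_induction (P : R -> R -> R -> Prop) :
  (forall a c l, in_unit_square a c l ->
    P a c (l / 2) -> P (a + l / 2) c (l / 2) -> P a (c + l / 2) (l / 2) ->
    P (a + l / 2) (c + l / 2) (l / 2) -> P a c l) ->
  (forall x y, 0 <= x <= 1 -> 0 <= y <= 1 -> exists2 d : R, 0 < d &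
    forall a c l, in_unit_square a c l -> l < d -> a <= x <= a + l ->
      c <= y <= c + l -> P a c l) ->
  P 0 0 1.
Proof.
move=> Phalf Ploc; apply: contrapT => nP.
pose l n : R := (1 / 2) ^+ n.
have lS n : l n.+1 = l n / 2 by rewrite /l exprS; ring.
have l0 n : 0 < l n by rewrite exprn_gt0.
pose bad n (p : R * R) := in_unit_square p.1 p.2 (l n) /\ ~ P p.1 p.2 (l n).
pose sub n (p q : R * R) := [/\ p.1 <= q.1, q.1 + l n.+1 <= p.1 + l n,
  p.2 <= q.2 & q.2 + l n.+1 <= p.2 + l n].
(* The existence is made total, with the arbitrary value (0, 0) on squares that are not bad, so that
   [choice] yields a function. *)
have step (np : nat * (R * R)) : exists q, bad np.1 np.2 -> bad np.1.+1 q /\ sub np.1 np.2 q.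
  case: np => n [a c] /=.
  have [[/= sq nPac]|nb] := pselect (bad n (a, c)); last by exists (0, 0).
  apply: contrapT => H; apply: nPac; apply: Phalf => //; case: (sq) => h0 h1 h2 h3 h4;
    (have ln := l0 n); apply: contrapT => nP'; apply: H.
  - exists (a, c) => _; rewrite /bad /sub lS /=; split; split => //; try split; lra.
  - exists (a + l n / 2, c) => _; rewrite /bad /sub lS /=; split; split => //; try split; lra.
  - exists (a, c + l n / 2) => _; rewrite /bad /sub lS /=; split; split => //; try split; lra.
  - exists (a + l n / 2, c + l n / 2) => _; rewrite /bad /sub lS /=; split; split => //; try split; lra.
have [f fP] := choice step.
pose u := fix u n := if n is m.+1 then f (m, u m) else (0, 0).
have ub n : bad n (u n).
  elim: n => [|n /(fP (n, u n))[]//].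
  by split => //=; rewrite /l expr0; split; lra.
have us n : sub n (u n) (u n.+1) by have [] := fP (n, u n) (ub n).
(* Nested intervals, for either coordinate [p]: the supremum of the left ends lies in all of
   them. *)
have lim (p : R * R -> R) : (forall n, p (u n) <= p (u n.+1)) ->
    (forall n, p (u n.+1) + l n.+1 <= p (u n) + l n) ->
    exists x, forall n, p (u n) <= x <= p (u n) + l n.
  move=> h1 h2.
  have mono : {homo (fun n => p (u n)) : m n / (m <= n)%N >-> m <= n} by apply: homo_leq => [x|y x z|n]; [exact: lexx|exact: le_trans|exact: h1].
  have anti : {homo (fun n => p (u n) + l n) : m n / (m <= n)%N >-> n <= m}.
    by apply: homo_leq => [x|y x z xy yz|n]; [exact: lexx|exact: le_trans yz xy|exact: h2].
  pose S := range (fun n => p (u n)).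
  have Sub n : ubound S (p (u n) + l n).
    move=> _ [m _ <-]; have [mn|/ltnW nm] := leqP m n.
      by rewrite (le_trans (mono _ _ mn)) // lerDl ltW.
    by rewrite (le_trans _ (anti _ _ nm)) // lerDl ltW.
  have Ssup : has_sup S by split; [exists (p (u 0%N)); exists 0%N|exists (p (u 0%N) + l 0%N)].
  exists (sup S) => n; apply/andP; split; first by apply: (sup_upper_bound Ssup); exists n.
  by apply: (sup_le_ub (proj1 Ssup)); exact: Sub.
have [x xP] := lim fst (fun n => let: And4 a b c d := us n in a) (fun n => let: And4 a b c d := us n in b).
have [y yP] := lim snd (fun n => let: And4 a b c d := us n in c) (fun n => let: And4 a b c d := us n in d).
have [[_ x0 x1 y0 y1] _] := ub 0%N.
have x01 : 0 <= x <= 1 by have /andP[] := xP 0%N; rewrite /= /l expr0 => ? ?; lra.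
have y01 : 0 <= y <= 1 by have /andP[] := yP 0%N; rewrite /= /l expr0 => ? ?; lra.
have [d d0 dP] := Ploc x y x01 y01.
have [n nd] := exists_half_expn_lt d0.
have [sq] := ub n; apply; exact: dP.
Qed.

Definition cdiff (f : C -> C) (z d : C) := forall e : R, 0 < e ->
  exists2 r : R, 0 < r & forall h, nrm h < r ->
    nrm (f (z + h) - f z - d * h) <= e * nrm h.

Definition affc (p0 p1 : C) (x : R) : C := p0 + p1 * (x%:C)%C.

Lemma ccont_affc p0 p1 x : ccont (affc p0 p1) x.
Proof.
apply: ccontD; first exact: ccont_cst.
by apply: ccontM; [exact: ccont_cst|exact: ccont_id].
Qed.

Lemma affcB p0 p1 x y : affc p0 p1 x - affc p0 p1 y = p1 * ((x - y)%:C)%C.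
Proof. by rewrite /affc rmorphB; ring. Qed.

Lemma cdiff_ccont (g : C -> C) (H : R -> C) x d :
  cdiff g (H x) d -> ccont H x -> ccont (fun t => g (H t)) x.
Proof.
move=> gd cH e e0.
have [r r0 gr] := gd 1 ltr01.
have K0 : 0 < 1 + nrm d by have := nrm_ge0 d; lra.
have e'0 : 0 < Num.min (r / 2) (e / (1 + nrm d)).
  by rewrite lt_min !divr_gt0.
have [s s0 Hs] := cH _ e'0; exists s => // y /Hs.
rewrite le_min => /andP[h1 h2].
have := gr (H y - H x); rewrite (addrC (H x)) subrK => /(_ ltac:(lra)).
rewrite ler_pdivlMr // in h2.
set D := H y - H x in h1 h2 *.
move=> h3; have -> : g (H y) - g (H x) = (g (H y) - g (H x) - d * D) + d * D by ring.
rewrite (le_trans (nrmD _ _)) // nrmM; lra.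
Qed.

(* [0,1]^2 is mapped to a quadrilateral by (x, y) |-> p x * q y, and bdry g    *)
(* is the integral of g(z) dz along the image of the boundary of the square    *)
(* [a, a + l] x [c, c + l].                                                    *)
Section Quadrilateral.
Variables p0 p1 q0 q1 : C.
Let p := affc p0 p1.
Let q := affc q0 q1.

Definition bdry (g : C -> C) (a c l : R) : C :=
  cint a (a + l) (fun x => g (p x * q c) * (p1 * q c))
  + cint c (c + l) (fun y => g (p (a + l) * q y) * (p (a + l) * q1))
  - cint a (a + l) (fun x => g (p x * q (c + l)) * (p1 * q (c + l)))
  - cint c (c + l) (fun y => g (p a * q y) * (p a * q1)).

(** Continuity of [g] on the quadrilateral, tested along continuous curves: this is what
    integrability of [g] along the edges asks for. *)
Definition gcont (g : C -> C) := forall x y, 0 <= x <= 1 -> 0 <= y <= 1 ->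
  (forall H : R -> C, (forall t, ccont H t) -> forall t, H t = p x * q y ->
     ccont (fun t => g (H t)) t).

Lemma ccont_p (k : C) x : ccont (fun t => p t * k) x.
Proof. by apply: ccontM; [exact: ccont_affc|exact: ccont_cst]. Qed.

Lemma ccont_q (k : C) x : ccont (fun t => k * q t) x.
Proof. by apply: ccontM; [exact: ccont_cst|exact: ccont_affc]. Qed.

Lemma gcont_x g k a b y : gcont g -> 0 <= a -> b <= 1 -> 0 <= y <= 1 ->
  ccont_on a b (fun x => g (p x * q y) * k).
Proof.
move=> cg a0 b1 y01 x /andP[ax xb]; apply: ccontM; last exact: ccont_cst.
apply: (cg x y) => //; last by move=> t; exact: ccont_p.
by rewrite (le_trans a0) ?(le_trans xb).
Qed.

Lemma gcont_y g k a b x : gcont g -> 0 <= a -> b <= 1 -> 0 <= x <= 1 ->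
  ccont_on a b (fun y => g (p x * q y) * k).
Proof.
move=> cg a0 b1 x01 y /andP[ay yb]; apply: ccontM; last exact: ccont_cst.
apply: (cg x y) => //; last by move=> t; exact: ccont_q.
by rewrite (le_trans a0) ?(le_trans yb).
Qed.

(** Each inner edge is run through twice, in opposite directions, and cancels. *)
Lemma bdry_split g a c l : gcont g -> in_unit_square a c l ->
  bdry g a c l = bdry g a c (l / 2) + bdry g (a + l / 2) c (l / 2)
    + bdry g a (c + l / 2) (l / 2) + bdry g (a + l / 2) (c + l / 2) (l / 2).
Proof.
move=> cg [l0 a0 a1 c0 c1]; rewrite /bdry.
have hh (t : R) : t + l / 2 + l / 2 = t + l by field.
rewrite !hh.
rewrite (@cint_split _ a (a + l / 2) (a + l) (fun x => g (p x * q c) * _)); [|lra|lra|by apply: gcont_x => //; lra].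
rewrite (@cint_split _ c (c + l / 2) (c + l) (fun y => g (p (a + l) * q y) * _)); [|lra|lra|by apply: gcont_y => //; lra].
rewrite (@cint_split _ a (a + l / 2) (a + l) (fun x => g (p x * q (c + l)) * _)); [|lra|lra|by apply: gcont_x => //; lra].
rewrite (@cint_split _ c (c + l / 2) (c + l) (fun y => g (p a * q y) * _)); [|lra|lra|by apply: gcont_y => //; lra].
(* A, B, C, D are the halves of the outer edges; V and H are the vertical and horizontal inner
   edges, which drop out. *)
have rearr (A1 A2 B1 B2 C1 C2 D1 D2 V1 V2 H1 H2 : C) :
    A1 + A2 + (B1 + B2) - (C1 + C2) - (D1 + D2) =
    A1 + V1 - H1 - D1 + (A2 + B1 - H2 - V1) + (H1 + V2 - C1 - D2) + (H2 + B2 - C2 - V2).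
  by ring.
exact: rearr.
Qed.

Lemma bdryD g h a c l : gcont g -> gcont h -> in_unit_square a c l ->
  bdry (fun z => g z + h z) a c l = bdry g a c l + bdry h a c l.
Proof.
move=> cg ch [l0 a0 a1 c0 c1]; rewrite /bdry.
have X y : 0 <= y <= 1 -> cint a (a + l) (fun x => (g (p x * q y) + h (p x * q y)) * (p1 * q y)) =
   cint a (a + l) (fun x => g (p x * q y) * (p1 * q y)) + cint a (a + l) (fun x => h (p x * q y) * (p1 * q y)).
  move=> y01; rewrite -cintD; [|by apply: gcont_x|by apply: gcont_x].
  by apply: eq_cint => x _; rewrite mulrDl.
have Y x : 0 <= x <= 1 -> cint c (c + l) (fun y => (g (p x * q y) + h (p x * q y)) * (p x * q1)) =
   cint c (c + l) (fun y => g (p x * q y) * (p x * q1)) + cint c (c + l) (fun y => h (p x * q y) * (p x * q1)).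
  move=> x01; rewrite -cintD; [|by apply: gcont_y|by apply: gcont_y].
  by apply: eq_cint => y _; rewrite mulrDl.
have i0 : 0 <= c <= 1 by lra.
have i1 : 0 <= c + l <= 1 by lra.
have i2 : 0 <= a <= 1 by lra.
have i3 : 0 <= a + l <= 1 by lra.
rewrite (X c i0) (X (c + l) i1) (Y a i2) (Y (a + l) i3).
have rearr (A A' B B' D D' E E' : C) :
    A + A' + (B + B') - (D + D') - (E + E') = A + B - D - E + (A' + B' - D' - E').
  by ring.
exact: rearr.
Qed.

Lemma gcont_affine (u v : C) : gcont (fun z => u + v * z).
Proof.
move=> x y _ _ H cH t _; apply: ccontD; first exact: ccont_cst.
by apply: ccontM => //; exact: ccont_cst.
Qed.

(** An affine function has a primitive. On each edge the integrand is affine in the parameter, so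
    [cint_affine] evaluates the four integrals and the sum is checked by algebra. *)
Lemma bdry_affine (u v : C) a c l : 0 < l -> bdry (fun z => u + v * z) a c l = 0.
Proof.
move=> l0; rewrite /bdry.
have X (y : R) : cint a (a + l) (fun x => (u + v * (p x * q y)) * (p1 * q y)) =
    u * (p1 * q y) * (l%:C)%C + v * q y * (p1 * q y) *
      (p0 * (l%:C)%C + p1 * ((((a + l) ^+ 2 - a ^+ 2) / 2)%:C)%C).
  rewrite (@eq_cint _ _ _ _ (fun x => (u * (p1 * q y) + v * q y * (p1 * q y) * p0) +
       (v * q y * (p1 * q y) * p1) * (x%:C)%C)); last by move=> x _; rewrite /p /affc; ring.
  rewrite cint_affine; last lra.
  rewrite (_ : a + l - a = l); [ring|ring].
have Y (x : R) : cint c (c + l) (fun y => (u + v * (p x * q y)) * (p x * q1)) =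
    u * (p x * q1) * (l%:C)%C + v * p x * (p x * q1) *
      (q0 * (l%:C)%C + q1 * ((((c + l) ^+ 2 - c ^+ 2) / 2)%:C)%C).
  rewrite (@eq_cint _ _ _ _ (fun y => (u * (p x * q1) + v * p x * (p x * q1) * q0) +
       (v * p x * (p x * q1) * q1) * (y%:C)%C)); last by move=> y _; rewrite /q /affc; ring.
  rewrite cint_affine; last lra.
  rewrite (_ : c + l - c = l); [ring|ring].
rewrite !X !Y /p /q /affc.
rewrite !rmorphM !rmorphB !rmorphXn !rmorphD fmorphV /=.
rewrite (_ : (2%:C)%C = 2 :> C); last by rewrite rmorph_nat.
by field.
Qed.

Lemma nrm_affc_le (u v : C) x : 0 <= x <= 1 -> nrm (affc u v x) <= nrm u + nrm v.
Proof.
move=> x01; rewrite (le_trans (nrmD _ _)) // lerD2l nrmM nrm_real.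
rewrite -[leRHS]mulr1 ler_wpM2l ?nrm_ge0 // ger0_norm; lra.
Qed.

(** Four edges, each with the factor 2 of [cint_bound], give 8; the product of sums bounds the
    speeds [p1 * q y] and [p x * q1] of all edges. *)
Lemma bdry_bound g a c l (M : R) : gcont g -> in_unit_square a c l ->
  (forall x y, a <= x <= a + l -> c <= y <= c + l -> nrm (g (p x * q y)) <= M) ->
  nrm (bdry g a c l) <=
    8 * M * ((nrm p0 + nrm p1) * (nrm q0 + nrm q1)) * l.
Proof.
move=> cg [l0 a0 a1 c0 c1] gM; rewrite /bdry.
set K := _ * (nrm q0 + nrm q1).
have M0 : 0 <= M by apply: le_trans (gM a c _ _); rewrite ?nrm_ge0 //; lra.
have X y : c <= y <= c + l -> nrm (cint a (a + l) (fun x => g (p x * q y) * (p1 * q y))) <= 2 * (M * K) * l.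
  move=> yc; have := @cint_bound _ a (a + l) (fun x => g (p x * q y) * (p1 * q y)) (M * K).
  rewrite (_ : a + l - a = l); last by ring.
  apply; first lra; first by apply: gcont_x => //; lra.
  move=> x xa; rewrite nrmM ler_pM ?nrm_ge0 ?gM //.
  rewrite nrmM /K ler_pM ?nrm_ge0 //; first by rewrite lerDr nrm_ge0.
  by apply: nrm_affc_le; lra.
have Y x : a <= x <= a + l -> nrm (cint c (c + l) (fun y => g (p x * q y) * (p x * q1))) <= 2 * (M * K) * l.
  move=> xa; have := @cint_bound _ c (c + l) (fun y => g (p x * q y) * (p x * q1)) (M * K).
  rewrite (_ : c + l - c = l); last by ring.
  apply; first lra; first by apply: gcont_y => //; lra.
  move=> y yc; rewrite nrmM ler_pM ?nrm_ge0 ?gM //.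
  rewrite nrmM /K ler_pM ?nrm_ge0 //; last by rewrite lerDr nrm_ge0.
  by apply: nrm_affc_le; lra.
have -> : 8 * M * K * l = 2 * (M * K) * l + 2 * (M * K) * l + 2 * (M * K) * l + 2 * (M * K) * l.
  by ring.
apply: (le_trans (nrmB _ _)); apply: lerD; last by apply: Y; lra.
apply: (le_trans (nrmB _ _)); apply: lerD; last by apply: X; lra.
by apply: (le_trans (nrmD _ _)); apply: lerD; [apply: X|apply: Y]; lra.
Qed.

(** A bound of the boundary integral by e times [l ^+ 2] passes from four quarters to their union.
    It holds on small squares because [g] differs from an affine function, of integral 0, by at most
    e times a multiple of [l], along edges of total length O(l). *)
Lemma goursat g : (forall x y, 0 <= x <= 1 -> 0 <= y <= 1 ->
  exists d, cdiff g (p x * q y) d) -> bdry g 0 0 1 = 0.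
Proof.
move=> gd.
have cg : gcont g.
  move=> x y x01 y01 H cH t Ht; have [d gdxy] := gd x y x01 y01.
  by apply: (@cdiff_ccont _ _ _ d) => //; rewrite Ht.
pose K := (nrm p0 + nrm p1) * (nrm q0 + nrm q1).
have K0 : 0 <= K by rewrite mulr_ge0 ?addr_ge0 ?nrm_ge0.
(* 16 K^2 is the 8 K of [bdry_bound] times the 2 K that bounds distances inside the image of a
   square of side 1. *)
apply: (@nrm_small_eq0 _ _ _ (16 * K ^+ 2)) => e e0.
have: nrm (bdry g 0 0 1) <= 16 * K ^+ 2 * e * 1 ^+ 2; last by rewrite expr1n mulr1.
apply: (@square_induction (fun a c l => nrm (bdry g a c l) <= 16 * K ^+ 2 * e * l ^+ 2)).
  move=> a c l sq h1 h2 h3 h4; rewrite bdry_split //.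
  pose m := 16 * K ^+ 2 * e * (l / 2) ^+ 2.
  have -> : 16 * K ^+ 2 * e * l ^+ 2 = m + m + m + m by rewrite /m; field.
  apply: (le_trans (nrmD _ _)); apply: lerD h4.
  apply: (le_trans (nrmD _ _)); apply: lerD h3.
  exact: le_trans (nrmD _ _) (lerD h1 h2).
move=> x y x01 y01; have [d gdxy] := gd x y x01 y01.
have [r r0 gr] := gdxy e e0.
set z := p x * q y in gdxy gr.
(* This makes the image, of diameter at most 2 K l, fit in the disc of radius [r]; the + 1 covers K
   = 0. *)
exists (r / (2 * K + 1)); first by rewrite divr_gt0 //; lra.
move=> a c l sq lr xa yc; have [l0 a0 a1 c0 c1] := sq.
have dist x' y' : a <= x' <= a + l -> c <= y' <= c + l -> nrm (p x' * q y' - z) <= 2 * K * l.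
  move=> xa' yc'.
  have -> : p x' * q y' - z = (p x' - p x) * q y' + p x * (q y' - q y) by rewrite /z; ring.
  rewrite (le_trans (nrmD _ _)) // !affcB !nrmM !nrm_real.
  have n1 : nrm (p x) <= nrm p0 + nrm p1 by exact: nrm_affc_le.
  have n2 : nrm (q y') <= nrm q0 + nrm q1 by apply: nrm_affc_le; lra.
  have n3 : `|x' - x| <= l by rewrite ler_norml; lra.
  have n4 : `|y' - y| <= l by rewrite ler_norml; lra.
  have b1 : nrm p1 * `|x' - x| * nrm (q y') <= (nrm p0 + nrm p1) * l * (nrm q0 + nrm q1).
    by rewrite !ler_pM ?mulr_ge0 ?nrm_ge0 // lerDr nrm_ge0.
  have b2 : nrm (p x) * (nrm q1 * `|y' - y|) <= (nrm p0 + nrm p1) * ((nrm q0 + nrm q1) * l).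
    by rewrite !ler_pM ?mulr_ge0 ?nrm_ge0 // lerDr nrm_ge0.
  rewrite /K; lra.
(* [A] is the first-order expansion of [g] at [z], and [E] below is its remainder. *)
pose A w := (g z - d * z) + d * w.
pose E w := g w - A w.
have cE : gcont E.
  move=> x' y' x'01 y'01 H cH t Ht.
  have c1' := cg _ _ x'01 y'01 H cH t Ht.
  have c2' := @gcont_affine (- (g z - d * z)) (- d) _ _ x'01 y'01 H cH t Ht.
  have -> : (fun t => E (H t)) = (fun t => g (H t) + (- (g z - d * z) + (- d) * H t)).
    by apply/funext => s; rewrite /E /A; ring.
  exact: ccontD.
have -> : bdry g a c l = bdry A a c l + bdry E a c l.
  rewrite -bdryD //; last exact: gcont_affine.
  by congr (bdry _ a c l); apply/funext => w; rewrite /E addrC subrK.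
rewrite bdry_affine // add0r.
have := @bdry_bound E a c l (e * (2 * K * l)) cE sq.
rewrite -/K (_ : 8 * _ * K * l = 16 * K ^+ 2 * e * l ^+ 2); last by ring.
apply => x' y' xa' yc'.
have ds := dist x' y' xa' yc'.
have -> : E (p x' * q y') = g (z + (p x' * q y' - z)) - g z - d * (p x' * q y' - z).
  by rewrite /E /A (addrC z) subrK; ring.
rewrite (le_trans (gr _ _)) //; last by rewrite ler_wpM2l // ltW.
rewrite ltr_pdivlMr in lr; last lra.
have := mulr_ge0 K0 (ltW l0); lra.
Qed.

End Quadrilateral.
End Goursat.

(** * Neighbourhoods, continuity and differentiability in terms of [nrm] *)

Section Bridge.
Context {R : realType}.
Local Notation C := R[i].

(** Radii of balls are positive elements of [R[i]]; positivity there forces the imaginary part to be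
    0, so real radii suffice. *)
Lemma near_nrm (V : normedModType C) (a : V) (P : V -> Prop) :
  (\forall z \near a, P z) <->
  exists2 d : R, 0 < d & forall h, nrm h < d -> P (a + h).
Proof.
split.
  move=> /nbhs_normP[e /= e0 H].
  have eE : e = ((complex.Re e)%:C)%C.
    by case: e e0 {H} => x y; rewrite ltcE /= => /andP[/eqP -> _].
  exists (complex.Re e); first by move: e0; rewrite ltcE => /andP[].
  move=> h hd; apply: H; rewrite /ball_ /=.
  by rewrite opprD addrA subrr add0r normrN nrmE eE ltcR.
move=> [d d0 H]; apply/nbhs_normP; exists ((d%:C)%C); first by rewrite /= ltcR.
move=> z; rewrite /ball_ /= nrmE ltcR nrmC => zd.
by have := H _ zd; rewrite addrC subrK.
Qed.

Lemma continuous_nrmP (U V : normedModType C) (f : U -> V) (a : U) :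
  {for a, continuous f} <-> forall e : R, 0 < e -> exists2 d : R, 0 < d &
    forall h, nrm h < d -> nrm (f (a + h) - f a) <= e.
Proof.
split.
  move=> cf e e0; apply/(@near_nrm U a (fun z => nrm (f z - f a) <= e)).
  have e0' : 0 < ((e%:C)%C : C) by rewrite ltcR.
  move/cvgrPdist_le : (cf) => /(_ _ e0'); apply: filterS => z.
  by rewrite nrmE lecR nrmC.
move=> H; apply/cvgrPdist_le => e e0.
have eE : e = ((complex.Re e)%:C)%C.
  by case: e e0 => x y; rewrite ltcE /= => /andP[/eqP -> _].
have e0' : 0 < complex.Re e by move: e0; rewrite ltcE => /andP[].
have /(@near_nrm U a (fun z => nrm (f z - f a) <= _)) := H _ e0'; apply: filterS => z.
by rewrite nrmE eE lecR nrmC.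
Qed.

Lemma differentiable_nrm (U V : normedModType C) (f : U -> V) (a : U) :
  differentiable f a -> forall e : R, 0 < e -> exists2 d : R, 0 < d &
    forall h, nrm h < d -> nrm (f (a + h) - f a - 'D_h f a) <= e * nrm h.
Proof.
move=> df e e0.
have e0' : 0 < ((e%:C)%C : C) by rewrite ltcR.
have [_ H] := (diff_locallyP _ _).1 df.
have /eqaddoP /(_ _ e0') := H.
move=> /near_nrm[d d0 Hd]; exists d => // h hd.
have := Hd _ hd; rewrite !add0r /=.
rewrite deriveE // !nrmE -rmorphM lecR.
suff -> : (f \o +%R^~ a - (cst (f a) + 'd f a)) h = f (a + h) - f a - 'd f a h by [].
by rewrite -[LHS]/(f (h + a) - (f a + 'd f a h)) opprD addrA (addrC a).
Qed.

Lemma continuous_ccont (g : C^o -> C^o) (H : R -> C) x :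
  {for H x, continuous g} -> ccont H x -> ccont (fun t => g (H t) : C) x.
Proof.
move=> /continuous_nrmP cg cH e e0; have [r r0 gr] := cg e e0.
have r2 : 0 < r / 2 by rewrite divr_gt0.
have [s s0 Hs] := cH _ r2; exists s => // y /Hs h.
have := gr (H y - H x); rewrite (addrC (H x)) subrK; apply.
by apply: le_lt_trans h _; lra.
Qed.

Lemma differentiable_cdiff (f : C^o -> C^o) (z : C^o) :
  differentiable f z -> cdiff f z ('D_1 f z).
Proof.
move=> df e e0; have [d d0 H] := differentiable_nrm df e0; exists d => // h hd.
have := H h hd; rewrite !deriveE // -{2}[h]mulr1 -[h * 1]/(h *: (1 : C^o)) linearZ.
by rewrite (mulrC ('d f z 1 : C) h).
Qed.

End Bridge.

(** * Quotients by powers of the variable *)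

Section DivPow.
Context {K : numFieldType}.

Lemma differentiable_expn (z : K^o) (k : nat) :
  differentiable (fun w : K^o => w ^+ k : K^o) z.
Proof.
case: k => [|k]; first exact: differentiable_cst.
have -> : (fun w : K^o => w ^+ k.+1 : K^o) = (id : K^o -> K^o) ^+ k.+1.
  by apply/funext => w; rewrite fctE.
exact: differentiableX.
Qed.

Lemma differentiable_exprV (z : K^o) (k : nat) : z != 0 ->
  differentiable (fun w : K^o => (w ^+ k)^-1 : K^o) z.
Proof.
move=> z0; apply: differentiableV; last by rewrite expf_neq0.
exact: differentiable_expn.
Qed.

Lemma differentiable_divX (f : K^o -> K^o) (z : K^o) (k : nat) : z != 0 ->
  differentiable f z -> differentiable (fun w => f w / w ^+ k : K^o) z.
Proof. by move=> z0 df; exact: differentiableM df (differentiable_exprV k z0). Qed.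

Lemma continuous_divX (f : K^o -> K^o) (z : K^o) (k : nat) : z != 0 ->
  {for z, continuous f} -> {for z, continuous (fun w => f w / w ^+ k : K^o)}.
Proof.
move=> z0 cf; apply: continuousM cf _.
exact/differentiable_continuous/differentiable_exprV.
Qed.

End DivPow.

(** * Cauchy's formula on a square *)

Section SquareCauchy.
Context {R : realType}.
Local Notation C := R[i].
Local Notation I := ('i%C : C).

(* sq k y runs, for 0 <= y <= 1, through the k-th side of the square of       *)
(* vertices +-1 +-i.                                                          *)
Definition side (y : R) : C := affc (1 - I) (2 * I) y.
Definition sq (k : nat) (y : R) : C := I ^+ k * side y.

Lemma sideE y : side y = ((1 : R)%:C)%C + I * ((2 * y - 1)%:C)%C.
Proof.
rewrite /side /affc rmorphB rmorphM /= (_ : (2%:C)%C = 2 :> C); last by rewrite rmorph_nat.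
by rewrite rmorph1; ring.
Qed.

Lemma nrm_ipow k : nrm (I ^+ k) = 1.
Proof. by rewrite nrmX nrm_i expr1n. Qed.

Lemma ipow_neq0 k : I ^+ k != 0.
Proof. by apply/eqP => h; have := nrm_ipow k; rewrite h nrm0; lra. Qed.

Lemma nrm_sq k y : 0 <= y <= 1 -> 1 <= nrm (sq k y) <= 2.
Proof.
move=> y01; rewrite /sq nrmM nrm_ipow mul1r sideE; apply/andP; split.
  apply: le_trans (Re_le_nrm _); rewrite ReD ReM /= !(mul0r, mulr0, oppr0, addr0).
  by rewrite normr1.
rewrite (le_trans (nrmD _ _)) // nrmM nrm_i mul1r !nrm_real normr1.
have : `|2 * y - 1| <= 1 by rewrite ler_norml; lra.
lra.
Qed.

Lemma sq_neq0 k y : 0 <= y <= 1 -> sq k y != 0.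
Proof.
move=> y01; apply/eqP => h; have := nrm_sq k y01; rewrite h nrm0; lra.
Qed.

Lemma side_neq0 y : 0 <= y <= 1 -> side y != 0.
Proof. by move=> /(sq_neq0 0); rewrite /sq expr0 mul1r. Qed.

Lemma ccont_sq k y : ccont (sq k) y.
Proof. by apply: ccontM; [exact: ccont_cst|exact: ccont_affc]. Qed.

(** By [nrm_sq] the contour lies in this annulus, so continuity there makes the integrals of [sqint]
    meaningful. *)
Definition annulus_cont (psi : C^o -> C^o) :=
  forall z : C^o, 1 <= nrm z <= 2 -> {for z, continuous psi}.

(* The integral of psi(z) / z^2 dz along the square of vertices +-1 +-i.       *)
Definition sqint (psi : C^o -> C^o) : C :=
  \sum_(k < 4) cint 0 1 (fun y => psi (sq k y) / sq k y ^+ 2 * (I ^+ k * (2 * I))).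

Lemma sqint_ccont psi k : annulus_cont psi ->
  ccont_on 0 1 (fun y => psi (sq k y) / sq k y ^+ 2 * (I ^+ k * (2 * I))).
Proof.
move=> cpsi y y01; apply: ccontM; last exact: ccont_cst.
have := @continuous_ccont _ (fun z : C^o => psi z / z ^+ 2 : C^o) (sq k) y.
apply; last exact: ccont_sq.
apply: continuous_divX; first exact: sq_neq0.
by apply: cpsi; exact: nrm_sq.
Qed.

Lemma eq_sqint psi1 psi2 : (forall z, 1 <= nrm z <= 2 -> psi1 z = psi2 z) ->
  sqint psi1 = sqint psi2.
Proof.
move=> e; apply: eq_bigr => k _; apply: eq_cint => y y01.
by rewrite e //; exact: nrm_sq.
Qed.

Lemma sqintD psi1 psi2 : annulus_cont psi1 -> annulus_cont psi2 ->
  sqint (fun z => psi1 z + psi2 z) = sqint psi1 + sqint psi2.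
Proof.
move=> c1 c2; rewrite /sqint -big_split /=; apply: eq_bigr => k _.
rewrite -cintD; [|exact: sqint_ccont|exact: sqint_ccont].
by apply: eq_cint => y _; rewrite mulrDl mulrDl.
Qed.

Lemma sqintZ (a : C) psi : annulus_cont psi ->
  sqint (fun z => a * psi z) = a * sqint psi.
Proof.
move=> c; rewrite /sqint mulr_sumr; apply: eq_bigr => k _.
rewrite -cintZ; last exact: sqint_ccont.
by apply: eq_cint => y _; ring.
Qed.

Lemma annulus_contD psi1 psi2 : annulus_cont psi1 -> annulus_cont psi2 ->
  annulus_cont (fun z => psi1 z + psi2 z).
Proof. by move=> c1 c2 z z12; apply: continuousD; [exact: c1|exact: c2]. Qed.

Lemma annulus_contZ (a : C) psi : annulus_cont psi ->
  annulus_cont (fun z => a * psi z).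
Proof.
move=> c z z12; apply: (@continuous_comp C^o C^o C^o psi (fun t : C^o => a *: t)).
  exact: c.
exact: scaler_continuous.
Qed.

Lemma sqintB psi1 psi2 : annulus_cont psi1 -> annulus_cont psi2 ->
  sqint (fun z => psi1 z + -1 * psi2 z) = sqint psi1 - sqint psi2.
Proof.
by move=> c1 c2; rewrite (sqintD c1 (annulus_contZ (a := -1) c2)) (sqintZ _ c2) mulN1r.
Qed.

Lemma annulus_contB psi1 psi2 : annulus_cont psi1 -> annulus_cont psi2 ->
  annulus_cont (fun z => psi1 z + -1 * psi2 z).
Proof. by move=> c1 c2; apply: annulus_contD c1 _; exact: annulus_contZ. Qed.

(** On each of the four sides the integrand is at most 2 M, since the contour has modulus at least 1
    and speed 2; [cint_bound] doubles this. *)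
Lemma sqint_bound psi (M : R) : annulus_cont psi ->
  (forall z, 1 <= nrm z <= 2 -> nrm (psi z) <= M) -> nrm (sqint psi) <= 16 * M.
Proof.
move=> c pM.
have H k : nrm (cint 0 1 (fun y => psi (sq k y) / sq k y ^+ 2 * (I ^+ k * (2 * I)))) <= 4 * M.
  have := @cint_bound _ 0 1 _ (2 * M) (ltW ltr01) (@sqint_ccont psi k c).
  rewrite (_ : 2 * (2 * M) * (1 - 0) = 4 * M); last by ring.
  apply => y y01; have /andP[n1 n2] := nrm_sq k y01.
  rewrite !nrmM nrm_ipow nrm_i nrm_nat nrmV nrmX mul1r mulr1 mulrC.
  rewrite ler_wpM2l // ler_pdivrMr; last by rewrite exprn_gt0 //; lra.
  have p := pM _ (nrm_sq k y01); apply: (le_trans p).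
  have M0 : 0 <= M by apply: le_trans p; exact: nrm_ge0.
  by rewrite ler_peMr // exprn_ege1.
rewrite /sqint !big_ord_recl big_ord0 addr0.
rewrite (_ : 16 * M = 4 * M + (4 * M + (4 * M + 4 * M))); last by ring.
by do 3 apply: (le_trans (nrmD _ _)) (lerD (H _) _); exact: H.
Qed.

Lemma I2 : I * I = -1.
Proof. by rewrite -expr2 sqr_i. Qed.

Lemma annulus_cont_cst (a : C) : annulus_cont (fun=> a).
Proof. by move=> z _; exact: cst_continuous. Qed.

Lemma annulus_cont_id : annulus_cont id.
Proof. by move=> z _; exact: cvg_id. Qed.

(** The sides are rotations of one another by powers of i, so side k contributes i^(-k) times the
    first one, and these factors sum to 0. *)
Lemma sqint1 : sqint (fun=> 1) = 0.
Proof.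
have -> : sqint (fun=> 1) = \sum_(k < 4) (I ^+ k)^-1 * cint 0 1 (fun y => 2 * I / side y ^+ 2).
  apply: eq_bigr => k _; rewrite -cintZ.
    apply: eq_cint => y y01; have := side_neq0 y01; have := ipow_neq0 k.
    by rewrite /sq => h1 h2; field; rewrite h1 h2.
  move=> y y01; have := @continuous_ccont _ (fun z : C^o => 2 * I / z ^+ 2 : C^o) side y.
  apply; last exact: ccont_affc.
  apply: continuous_divX; first exact: side_neq0.
  exact: cst_continuous.
rewrite -mulr_suml !big_ord_recl big_ord0 /= /bump /=.
have i0 : I != 0 by have := ipow_neq0 1; rewrite expr1.
have -> : (I ^+ 2)^-1 = -1 by rewrite sqr_i invrN1.
have -> : (I ^+ 3)^-1 = - I^-1 by rewrite exprS sqr_i mulrN1 invrN.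
by rewrite expr0 expr1 invr1; ring.
Qed.

(** The integral of dz / z, classically 2 pi i. *)
Definition kappa : C := sqint id.

(** dz / z is invariant under rotation, so the four sides contribute equally; on the first one the
    imaginary part of the integrand is at least 1. *)
Lemma kappa_neq0 : kappa != 0.
Proof.
have cs : ccont_on 0 1 (fun y => 2 * I / side y ^+ 1).
  move=> y y01; have := @continuous_ccont _ (fun z : C^o => 2 * I / z ^+ 1 : C^o) side y.
  apply; last exact: ccont_affc.
  apply: continuous_divX; first exact: side_neq0.
  exact: cst_continuous.
have -> : kappa = 4 * cint 0 1 (fun y => 2 * I / side y ^+ 1).
  rewrite /kappa /sqint (eq_bigr (fun=> cint 0 1 (fun y => 2 * I / side y ^+ 1))).
    by rewrite sumr_const card_ord [RHS]mulr_natl.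
  move=> k _; apply: eq_cint => y y01; have := side_neq0 y01; have := ipow_neq0 k.
  by rewrite /sq => h1 h2; field; rewrite h1 h2.
rewrite mulf_neq0 ?pnatr_eq0 //.
have hy y : 0 <= y <= 1 -> 1 <= complex.Im (2 * I / side y ^+ 1).
  move=> y01.
  have s0 := side_neq0 y01.
  have [v vE] : exists v, v = 2 * y - 1 by exists (2 * y - 1).
  have v1 : v ^+ 2 <= 1 by rewrite vE; nra.
  (* 2i / (1 + iv) = 2 (v + i) / (1 + v^2), of imaginary part 2 / (1 + v^2) with v^2 <= 1. *)
  have -> : 2 * I / side y ^+ 1 = ((2 / (1 + v ^+ 2))%:C)%C * (((v)%:C)%C + I * ((1 : R)%:C)%C).
    apply/eqP; rewrite expr1 eq_sym -subr_eq0 -(mulIr_eq0 _ (mulIf s0)) mulrBl divfK // subr_eq0; apply/eqP.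
    rewrite sideE -vE rmorph1.
    rewrite fmorph_div rmorph_nat rmorphD rmorphXn rmorph1 /=.
    have v0 : 1 + ((v%:C)%C) ^+ 2 != 0 :> C.
      rewrite -(rmorph1 (real_complex R)) -rmorphXn -rmorphD /=.
      apply/eqP => -[]; have := sqr_ge0 v; lra.
    have e : ((v%:C)%C + I * 1) * (1 + I * (v%:C)%C) = I * (1 + (v%:C)%C ^+ 2).
      have -> : ((v%:C)%C + I * 1) * (1 + I * (v%:C)%C) = (v%:C)%C + I + I * (v%:C)%C ^+ 2 + I * I * (v%:C)%C by ring.
      by rewrite I2; ring.
    by rewrite -mulrA e; field.
  rewrite ImM ImD ImM /= !mul0r !addr0 add0r !mulr1 add0r.
  by rewrite mulr1 ler_pdivlMr; [lra|have := sqr_ge0 v; lra].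
have h : 1 <= complex.Im (cint 0 1 (fun y => 2 * I / side y ^+ 1)).
  rewrite /cint /=.
  apply: (@le_trans _ _ (\int[@lebesgue_measure R]_(x in `[0, 1]) 1)).
    by rewrite Rint_cst //; lra.
  apply: le_Rintegral => //.
  - apply: continuous_compact_integrable; first exact: segment_compact.
    by apply: continuous_subspaceT => x; exact: cvg_cst.
  - exact: (integrable_Im cs).
apply/eqP => h0; move: h; rewrite h0 /=; lra.
Qed.

(* Goursat on each of the four trapezoids between the squares of half-sides t  *)
(* and s: the oblique sides of consecutive trapezoids cancel.                  *)
Lemma sqint_scale (phi : C^o -> C^o) (s t : R) : 0 < t -> t <= s ->
  (forall z : C^o, nrm z <= 2 * s -> differentiable phi z) ->
  (s%:C)%C^-1 * sqint (fun z => phi ((s%:C)%C * z)) =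
  (t%:C)%C^-1 * sqint (fun z => phi ((t%:C)%C * z)).
Proof.
move=> t0 ts dphi.
pose G (z : C) : C := phi z / z ^+ 2.
pose tc : C := (t%:C)%C; pose sc : C := (s%:C)%C.
have tc0 : tc != 0 by apply/eqP => -[]; lra.
have sc0 : sc != 0 by apply/eqP => -[]; lra.
pose P k x := affc (I ^+ k * tc) (I ^+ k * (sc - tc)) x.
have Pt k : P k 0 = I ^+ k * tc by rewrite /P /affc mulr0 addr0.
have Ps k : P k 1 = I ^+ k * sc by rewrite /P /affc mulr1; ring.
(* The integral along the oblique edge joining the k-th corners of the two squares. *)
pose X k := cint 0 1 (fun x => G (P k x * (1 - I)) * (I ^+ k * (sc - tc) * (1 - I))).
have scale (u : R) : 0 < u -> ((u%:C)%C : C)^-1 * sqint (fun z => phi ((u%:C)%C * z)) =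
   \sum_(k < 4) ((u%:C)%C^-1 * cint 0 1 (fun y => phi ((u%:C)%C * sq k y) / sq k y ^+ 2 * (I ^+ k * (2 * I)))).
  by move=> u0; rewrite mulr_sumr.
(* Goursat on the k-th trapezoid: outer side minus inner side is the difference of its oblique
   edges, the far one being [X k.+1] because i (1 - i) = 1 + i. *)
have B k : ((s%:C)%C : C)^-1 * cint 0 1 (fun y => phi (sc * sq k y) / sq k y ^+ 2 * (I ^+ k * (2 * I)))
   - ((t%:C)%C : C)^-1 * cint 0 1 (fun y => phi (tc * sq k y) / sq k y ^+ 2 * (I ^+ k * (2 * I)))
   = X k.+1 - X k.
  have hG : forall x y, 0 <= x <= 1 -> 0 <= y <= 1 ->
      exists d, cdiff G (affc (I ^+ k * tc) (I ^+ k * (sc - tc)) x * affc (1 - I) (2 * I) y) d.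
    move=> x y x01 y01; set z := _ * _.
    have zE : z = ((t + (s - t) * x)%:C)%C * sq k y.
      rewrite /z /sq /side /affc /tc /sc rmorphD rmorphM rmorphB /=; ring.
    have xx : 0 < t + (s - t) * x <= s by apply/andP; split; nra.
    have zn : nrm z <= 2 * s.
      rewrite zE nrmM nrm_real ger0_norm; last lra.
      have := nrm_sq k y01; nra.
    have z0 : z != 0.
      rewrite zE mulf_neq0 //; last exact: sq_neq0.
      by apply/eqP => -[]; lra.
    exists ('D_1 (fun w : C^o => phi w / w ^+ 2 : C^o) z).
    apply: differentiable_cdiff; apply: differentiable_divX => //.
    exact: dphi.
  have := goursat hG; rewrite /bdry !add0r.
  have -> : affc (1 - I) (2 * I) 0 = 1 - I by rewrite /affc mulr0 addr0.
  have -> : affc (1 - I) (2 * I) 1 = 1 + I by rewrite /affc mulr1; ring.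
  rewrite -/(P k _) -/(P k _) Ps Pt.
  have -> : cint 0 1 (fun x => G (affc (I ^+ k * tc) (I ^+ k * (sc - tc)) x * (1 - I)) * (I ^+ k * (sc - tc) * (1 - I))) = X k by [].
  have -> : cint 0 1 (fun x => G (affc (I ^+ k * tc) (I ^+ k * (sc - tc)) x * (1 + I)) * (I ^+ k * (sc - tc) * (1 + I))) = X k.+1.
    have e : I * (1 - I) = 1 + I by rewrite mulrBr I2; ring.
    apply: eq_cint => x _; rewrite /P /affc exprS.
    have -> : (I * I ^+ k * tc + I * I ^+ k * (sc - tc) * (x%:C)%C) * (1 - I) =
      (I ^+ k * tc + I ^+ k * (sc - tc) * (x%:C)%C) * (I * (1 - I)) by ring.
    have -> : I * I ^+ k * (sc - tc) * (1 - I) = I ^+ k * (sc - tc) * (I * (1 - I)) by ring.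
    by rewrite e.
  have Y (u : R) : 0 < u -> u <= s -> cint 0 1 (fun y => G (I ^+ k * (u%:C)%C * affc (1 - I) (2 * I) y) * (I ^+ k * (u%:C)%C * (2 * I))) =
     ((u%:C)%C : C)^-1 * cint 0 1 (fun y => phi ((u%:C)%C * sq k y) / sq k y ^+ 2 * (I ^+ k * (2 * I))).
    move=> u0 us.
    have uc0 : (u%:C)%C != 0 :> C by apply/eqP => -[]; lra.
    rewrite -cintZ.
      apply: eq_cint => y y01; rewrite /G -/(side y).
      have -> : I ^+ k * (u%:C)%C * side y = (u%:C)%C * sq k y by rewrite /sq; ring.
      by field; rewrite sq_neq0.
    apply: (@sqint_ccont (fun z => phi ((u%:C)%C * z))) => z z12.
    apply: (@continuous_comp _ _ _ (fun z : C^o => (u%:C)%C *: z : C^o) phi).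
      exact: scaler_continuous.
    apply: differentiable_continuous; apply: dphi.
    by rewrite nrmZ nrm_real gtr0_norm //; nra.
  rewrite !Y //; last lra.
  rewrite -/sc -/tc.
  set a := _ * _; set b := X k; set c := X _; set d := _ * _ => h.
  have := congr1 (fun z => z + c - b) h; rewrite add0r => <-; ring.
have -> : (s%:C)%C^-1 * sqint (fun z => phi ((s%:C)%C * z)) =
  (t%:C)%C^-1 * sqint (fun z => phi ((t%:C)%C * z)) + \sum_(k < 4) (X k.+1 - X k).
  rewrite !scale //; last lra.
  by rewrite -big_split /=; apply: eq_bigr => k _; rewrite -B addrC subrK.
rewrite !big_ord_recl big_ord0 /= /bump /=.
have -> : X 4%N = X 0%N.
  apply: eq_cint => x _; rewrite /P.
  by have -> : I ^+ 4 = I ^+ 0 by rewrite (exprM I 2 2) sqr_i sqrrN expr1n expr0.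
by rewrite !addn0 /=; ring.
Qed.

(** By [sqint_scale] the square may be shrunk. On a small one [phi] is its first-order expansion up
    to o(z): the constant integrates to 0 by [sqint1], the linear term to ['D_1 phi 0 * kappa], and
    the remainder is negligible. *)
Lemma cauchy_derivative (phi : C^o -> C^o) (s : R) : 0 < s ->
  (forall z : C^o, nrm z <= 2 * s -> differentiable phi z) ->
  'D_1 phi 0 = kappa^-1 * ((s%:C)%C^-1 * sqint (fun z => phi ((s%:C)%C * z))).
Proof.
move=> s0 dphi.
rewrite -[LHS](mulKf kappa_neq0); congr (_ * _).
apply/esym/eqP; rewrite -subr_eq0; apply/eqP.
apply: (@nrm_small_eq0 _ _ _ 32) => e e0.
have d0 : differentiable phi 0 by apply: dphi; rewrite nrm0; lra.
have [r r0 hr] := differentiable_cdiff d0 e0.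
(* The contour of scale [t] stays in the disc of radius 2 t < r where the expansion is
   controlled. *)
pose t := Num.min s (r / 4).
have t0 : 0 < t by rewrite lt_min s0 divr_gt0.
have ts : t <= s by rewrite ge_min lexx.
have tr : t <= r / 4 by rewrite ge_min lexx orbT.
have tc0 : (t%:C)%C != 0 :> C by apply/eqP => -[]; lra.
rewrite (sqint_scale t0 ts dphi).
pose d := 'D_1 phi 0.
pose E (z : C^o) : C^o := phi ((t%:C)%C * z) - phi 0 - d * ((t%:C)%C * z).
have cphi : annulus_cont (fun z => phi ((t%:C)%C * z)).
  move=> z z12; apply: (@continuous_comp _ _ _ (fun z : C^o => (t%:C)%C *: z : C^o) phi).
    exact: scaler_continuous.
  apply: differentiable_continuous; apply: dphi.
  by rewrite nrmZ nrm_real gtr0_norm //; nra.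
have clin : annulus_cont (fun z => - phi 0 + - (d * (t%:C)%C) * z).
  move=> z _; apply: continuousD; first exact: cst_continuous.
  exact: (@scaler_continuous _ C^o).
have cE : annulus_cont E.
  move=> z z12; have -> : E = (fun z => phi ((t%:C)%C * z) + (- phi 0 + - (d * (t%:C)%C) * z)).
    by apply/funext => w; rewrite /E; ring.
  by apply: continuousD; [exact: cphi|exact: clin].
have -> : sqint (fun z => phi ((t%:C)%C * z)) = sqint E + (d * (t%:C)%C) * kappa.
  rewrite (@eq_sqint _ (fun z => E z + (phi 0 * 1 + (d * (t%:C)%C) * z))); last first.
    by move=> z _; rewrite /E; ring.
  have c1 := annulus_cont_cst.
  have clin' : annulus_cont (fun z => d * (t%:C)%C * z).
    by move=> z _; exact: (@scaler_continuous _ C^o).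
  have c0 : annulus_cont (fun=> phi 0 * 1) by exact: c1.
  have cl : annulus_cont (fun z => phi 0 * 1 + d * (t%:C)%C * z).
    by move=> z z12; apply: continuousD; [exact: c0|exact: clin'].
  rewrite (sqintD cE cl) (sqintD c0 clin') (sqintZ (phi 0) (c1 1)) sqint1 mulr0 add0r.
  by rewrite (sqintZ _ annulus_cont_id).
have -> : (t%:C)%C^-1 * (sqint E + d * (t%:C)%C * kappa) - kappa * 'D_1 phi 0 = (t%:C)%C^-1 * sqint E.
  by rewrite -/d; field.
rewrite nrmM nrmV nrm_real gtr0_norm // ler_pdivrMl //.
have -> : t * (32 * e) = 16 * (e * (2 * t)) by ring.
apply: sqint_bound => // z z12; rewrite /E.
have tz : nrm ((t%:C)%C * z) <= 2 * t by rewrite nrmM nrm_real gtr0_norm //; nra.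
have := hr ((t%:C)%C * z); rewrite add0r => /(_ ltac:(lra)) /le_trans; apply.
by rewrite ler_wpM2l // ltW.
Qed.

End SquareCauchy.

(** * Cauchy's inequalities and Taylor remainders along lines *)

Section CauchyEstimates.
Context {R : realType}.
Local Notation C := R[i].

(** The constant of Cauchy's inequalities, with the 16 of [sqint_bound]. *)
Definition cauchyC : R := nrm (kappa^-1 : C) * 16.

Lemma cauchyC_ge0 : 0 <= cauchyC.
Proof. by rewrite mulr_ge0 ?nrm_ge0. Qed.

Section Directional.
Variable V : normedModType C.
Implicit Types (f : V -> C^o) (b v h : V) (s : R).

Lemma differentiable_line f b v (t : C^o) : differentiable f (b + t *: v) ->
  differentiable (fun t : C^o => f (b + t *: v)) t.
Proof.
by move=> df; apply: (@differentiable_comp _ _ _ _ (fun t : C^o => b + t *: v) f).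

Qed.

Lemma derive_line f b v (t : C^o) :
  'D_1 (fun t : C^o => f (b + t *: v)) t = 'D_v f (b + t *: v).
Proof.
rewrite /derive; set F := (X in X @ _); set G := (X in _ = lim (X @ _)).
suff -> : F = G by [].
apply/funext => h; rewrite /F /G /=.
by rewrite -[h *: 1]/(h * 1) mulr1 scalerDl addrCA.
Qed.

Lemma nrm_scaled (s : R) (z : C) : 0 < s -> 1 <= nrm z <= 2 -> nrm ((s%:C)%C * z) <= 2 * s.
Proof.
by move=> s0 z12; rewrite nrmM nrm_real gtr0_norm //; nra.
Qed.

Lemma line_annulus_cont f b v s : 0 < s ->
  (forall t : C, nrm t <= 2 * s -> {for b + t *: v, continuous f}) ->
  annulus_cont (fun z => f (b + ((s%:C)%C * z) *: v)).
Proof.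
move=> s0 cf z z12.
apply: (@continuous_comp _ _ _ (fun z : C^o => b + ((s%:C)%C * z) *: v : V) f).
  apply: continuousD; first exact: cst_continuous.
  apply: (@continuous_comp C^o C^o V (fun z : C^o => (s%:C)%C *: z : C^o) (fun t : C^o => t *: v)).
    exact: scaler_continuous.
  exact: scalel_continuous.
by apply: cf; exact: nrm_scaled.
Qed.

(** Cauchy's formula for the restriction of [f] to the complex line through [b] directed by [v]. *)
Lemma cauchy_directional f b v s : 0 < s ->
  (forall t : C, nrm t <= 2 * s -> differentiable f (b + t *: v)) ->
  'D_v f b = kappa^-1 * ((s%:C)%C^-1 * sqint (fun z => f (b + ((s%:C)%C * z) *: v))).
Proof.
move=> s0 df; rewrite -(@cauchy_derivative _ (fun t => f (b + t *: v)) s s0).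
  by rewrite derive_line scale0r addr0.
by move=> z zs; apply: differentiable_line; exact: df.
Qed.

Lemma nrm_cauchy_le (psi : C^o -> C^o) s (M : R) : 0 < s -> annulus_cont psi ->
  (forall z, 1 <= nrm z <= 2 -> nrm (psi z) <= M) ->
  nrm (kappa^-1 * ((s%:C)%C^-1 * sqint psi)) <= cauchyC * M / s.
Proof.
move=> s0 cp pM; have := sqint_bound cp pM.
rewrite !nrmM [X in _ * (X * _)]nrmV nrm_real gtr0_norm // => h.
rewrite /cauchyC -!mulrA ler_wpM2l ?nrm_ge0 //.
by rewrite mulrC mulrA ler_pM2r ?invr_gt0.
Qed.

Lemma cauchy_estimate f b v s (M : R) : 0 < s ->
  (forall t : C, nrm t <= 2 * s -> differentiable f (b + t *: v)) ->
  (forall t : C, nrm t <= 2 * s -> nrm (f (b + t *: v)) <= M) ->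
  nrm ('D_v f b) <= cauchyC * M / s.
Proof.
move=> s0 df fM; rewrite (cauchy_directional s0 df); apply: nrm_cauchy_le => //.
  by apply: line_annulus_cont => // t ts; exact/differentiable_continuous/df.
by move=> z z12; apply: fM; exact: nrm_scaled.
Qed.

(** The mean value theorem fails for complex values, so it is applied to a real part [p] of [f]
    along a real segment; [p] stands for [Re] and [Im] at once. *)
Lemma MVT_part (p : C -> R) f b h :
  (forall x y, p (x - y) = p x - p y) -> (forall (r : R) x, p ((r%:C)%C * x) = r * p x) ->
  (forall x, `|p x| <= nrm x) ->
  (forall t : R, 0 <= t <= 1 -> differentiable f (b + (t%:C)%C *: h)) ->
  exists2 c : R, 0 <= c <= 1 & p (f (b + h) - f b) = p ('D_h f (b + (c%:C)%C *: h)).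
Proof.
move=> pB pZ pn df.
pose g (t : R) : R := p (f (b + (t%:C)%C *: h)).
pose dg (t : R) : R := p ('D_h f (b + (t%:C)%C *: h)).
have dgP (t : R) : 0 <= t <= 1 -> is_derive t (1 : R) (g : R -> R) (dg t).
  move=> t01.
  have lim : (fun k : R => k^-1 *: ((g \o shift t) (k *: 1) - g t)) @ 0^' --> dg t.
    apply/cvgrPdist_le => e e0.
    (* The + 1 allows division even when [h] is 0. *)
    pose n := nrm h + 1; have n0 : 0 < n by rewrite ltr_wpDl ?nrm_ge0.
    have e'0 : 0 < e / n by rewrite divr_gt0.
    have [d d0 H] := differentiable_nrm (df t t01) e'0.
    apply/nbhs_ballP; exists (d / n); first by rewrite /= divr_gt0.
    move=> k; rewrite /ball /= sub0r normrN => kd k0.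
    have k1 : 0 < `|k| by rewrite normr_gt0.
    have hk : nrm ((k%:C)%C *: h) <= `|k| * n.
      by rewrite nrmZ nrm_real ler_wpM2l // lerDl.
    have hk2 : nrm ((k%:C)%C *: h) < d by rewrite (le_lt_trans hk) // -ltr_pdivlMr.
    have := H _ hk2.
    have -> : 'D_((k%:C)%C *: h) f (b + (t%:C)%C *: h) = (k%:C)%C * 'D_h f (b + (t%:C)%C *: h).
      by rewrite !deriveE; [rewrite linearZ|exact: df|exact: df].
    have -> : b + (t%:C)%C *: h + (k%:C)%C *: h = b + ((k + t)%:C)%C *: h.
      by rewrite rmorphD /= scalerDl -addrA [X in b + X]addrC.
    move=> /(le_trans (pn _)).
    rewrite !pB pZ -/(g _) -/(g _) -/(dg _) => H2.
    rewrite -[k *: 1]/(k * 1) mulr1 -[_ *: _]/(_ * _).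
    have -> : dg t - k^-1 * (g (k + t) - g t) = - k^-1 * (g (k + t) - g t - k * dg t).
      by field.
    rewrite normrM normrN normfV ler_pdivrMl //.
    apply: (le_trans H2); rewrite mulrAC ler_pdivrMr //.
    by rewrite -mulrA mulrCA ler_wpM2l ?(ltW e0) // mulrC.
  by apply: DeriveDef; [apply/cvg_ex; exists (dg t)|exact: cvg_lim lim].
have cg : {within `[0, 1], continuous g}.
  apply: continuous_in_subspaceT => x; rewrite inE /= in_itv /= => x01.
  have [dx _] := dgP x x01.
  by apply/differentiable_continuous/derivable1_diffP.
have [c] := @MVT R g dg 0 1 ltr01 (fun x xx => dgP x ltac:(by move: xx; rewrite in_itv /= => /andP[? ?]; rewrite !ltW)) cg.
rewrite in_itv /= => /andP[c0 c1]; rewrite subr0 mulr1 => e.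
exists c; first by rewrite !ltW.
by rewrite pB -[RHS]e /g scale1r scale0r addr0.
Qed.

(** The mean value point differs for [Re] and [Im], hence the factor 2. Taking [D = 0] bounds the
    increment, and [D = 'D_h f b] the Taylor remainder. *)
Lemma MVT_bound f b h (D : C) (M : R) :
  (forall t : R, 0 <= t <= 1 -> differentiable f (b + (t%:C)%C *: h)) ->
  (forall t : R, 0 <= t <= 1 -> nrm ('D_h f (b + (t%:C)%C *: h) - D) <= M) ->
  nrm (f (b + h) - f b - D) <= 2 * M.
Proof.
move=> df dM; apply: le_trans (nrm_le_ReIm _) _; rewrite mulr_natl mulr2n.
apply: lerD.
  have [|c c01 e] := @MVT_part (@complex.Re R) f b h ReB _ Re_le_nrm df.
    by move=> r x; rewrite ReM /= oppr0 mul0r addr0.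
  by rewrite ReB e -ReB (le_trans (Re_le_nrm _)) ?dM.
have [|c c01 e] := @MVT_part (@complex.Im R) f b h ImB _ Im_le_nrm df.
  by move=> r x; rewrite ImM /= mul0r addr0.
by rewrite ImB e -ImB (le_trans (Im_le_nrm _)) ?dM.
Qed.

(** The variation of ['D_h f] along the segment is the Cauchy integral of a difference of values of
    [f]. That difference is O(M / s) by Cauchy's inequality and the mean value theorem; the Cauchy
    integral gives a second factor 1 / s, without second derivatives. *)
Lemma taylor_estimate f b h s (M : R) : 1 <= s ->
  (forall t : C, nrm t <= 8 * s -> differentiable f (b + t *: h)) ->
  (forall t : C, nrm t <= 8 * s -> nrm (f (b + t *: h)) <= M) ->
  nrm (f (b + h) - f b - 'D_h f b) <= 4 * cauchyC ^+ 2 * M / s ^+ 2.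
Proof.
move=> s1 df fM; have s0 : 0 < s by lra.
(* Out of the radius 8 s, a margin of 2 s is kept for the Cauchy square. *)
have D1 (t : C) : nrm t <= 6 * s -> nrm ('D_h f (b + t *: h)) <= cauchyC * M / s.
  move=> ts; apply: cauchy_estimate => // u us; rewrite -addrA -scalerDl;
    have := nrmD t u => ?; [apply: df|apply: fM]; lra.
have F1 (t : R) (z : C) : 0 <= t <= 1 -> nrm z <= 2 * s ->
    nrm (f (b + z *: h + (t%:C)%C *: h) - f (b + z *: h)) <= 2 * (cauchyC * M / s).
  move=> t01 zs; rewrite -[X in nrm X]subr0; apply: MVT_bound => u u01; rewrite -addrA scalerA -rmorphM /= -scalerDl.
    apply: df; have := nrmD z (((u * t)%:C)%C); rewrite nrm_real.
    have : `|u * t| <= 1 by rewrite ler_norml; nra.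
    lra.
  rewrite subr0; set w := z + _.
  have wz : nrm w <= 6 * s.
    have := nrmD z (((u * t)%:C)%C); rewrite nrm_real -/w.
    have : `|u * t| <= 1 by rewrite ler_norml; nra.
    lra.
  have dw : differentiable f (b + w *: h) by apply: df; lra.
  rewrite deriveE // linearZ -deriveE // nrmZ nrm_real.
  have := D1 _ wz; have := nrm_ge0 ('D_h f (b + w *: h)).
  rewrite ger0_norm; last lra.
  by nra.
have -> : 4 * cauchyC ^+ 2 * M / s ^+ 2 = 2 * (cauchyC * (2 * (cauchyC * M / s)) / s).
  by field; rewrite gt_eqF.
apply: MVT_bound => t t01.
  apply: df; rewrite nrm_real ger0_norm; lra.
have dft (t' : R) : 0 <= t' <= 1 -> forall u : C, nrm u <= 2 * s ->
    differentiable f (b + (t'%:C)%C *: h + u *: h).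
  move=> t'01 u us; rewrite -addrA -scalerDl; apply: df.
  have := nrmD ((t'%:C)%C) u; rewrite nrm_real ger0_norm; lra.
have df0 (u : C) : nrm u <= 2 * s -> differentiable f (b + u *: h).
  by move=> us; apply: df; lra.
rewrite (cauchy_directional s0 (dft t t01)) (cauchy_directional s0 df0).
have c1 : annulus_cont (fun z => f (b + (t%:C)%C *: h + ((s%:C)%C * z) *: h)).
  by apply: line_annulus_cont => // u us; exact/differentiable_continuous/dft.
have c2 : annulus_cont (fun z => f (b + ((s%:C)%C * z) *: h)).
  by apply: line_annulus_cont => // u us; exact/differentiable_continuous/df0.
have E := sqintB c1 c2.
rewrite -mulrBr -mulrBr -E.
apply: (nrm_cauchy_le s0 (annulus_contB c1 c2)).
move=> z z12; rewrite mulN1r addrAC; apply: F1 => //.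
exact: nrm_scaled.
Qed.

End Directional.
End CauchyEstimates.

(** * Derivatives of holomorphic functions *)

Local Opaque derive sqint kappa cauchyC.

Section DerivativeHolomorphic.
Context {R : realType}.
Local Notation C := R[i].
Variable V : normedModType C.

Definition bounded_holo (f : V -> C^o) (rho M : R) := forall z, nrm z < rho ->
  differentiable f z /\ nrm (f z) <= M.

Section Fixed.
Variables (f : V -> C^o) (rho M : R).
Hypotheses (rho0 : 0 < rho) (fP : bounded_holo f rho M).

(** The bound of [derive_lipschitz] on ['D_k f] per unit of [nrm k], on the half ball. *)
Let B : R := 8 * cauchyC * M / rho.

Let M0 : 0 <= M.
Proof. by have [] := fP (z := 0) ltac:(by rewrite nrm0); move=> _; apply: le_trans; exact: nrm_ge0. Qed.

Let B0 : 0 <= B.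
Proof. exact: divr_ge0 (mulr_ge0 (mulr_ge0 (ler0n _ 8) cauchyC_ge0) M0) (ltW rho0). Qed.

Lemma derive_lipschitz x k : nrm x <= rho / 2 -> nrm ('D_k f x) <= B * nrm k.
Proof.
move=> xr; have [->|k0] := eqVneq k 0.
  have := nrm_ge0 (0 : V); rewrite nrm0 mulr0 => _.
  have [df _] := fP (z := x) ltac:(move: rho0 => ?; lra).
  by rewrite deriveE // linear0 nrm0.
have nk := nrm_gt0 k0.
(* A Cauchy square of this scale in direction [k] moves points by at most rho / 4. *)
have -> : B * nrm k = cauchyC * M / (rho / (8 * nrm k)).
  by rewrite /B; field; rewrite !gt_eqF.
have H (t : C) : nrm t <= 2 * (rho / (8 * nrm k)) -> nrm (x + t *: k) < rho.
  move=> ts; apply: (le_lt_trans (nrmD _ _)); rewrite nrmZ.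
  have : nrm t * nrm k <= 2 * (rho / (8 * nrm k)) * nrm k by rewrite ler_wpM2r ?nrm_ge0.
  have -> : 2 * (rho / (8 * nrm k)) * nrm k = rho / 4 by field; rewrite gt_eqF.
  by move: rho0 => ?; lra.
apply: cauchy_estimate; first by rewrite divr_gt0 // mulr_gt0.
- by move=> t /H /fP[].
- by move=> t /H /fP[].
Qed.

Lemma holo_lipschitz x h : nrm x <= rho / 2 -> nrm (x + h) <= rho / 2 ->
  nrm (f (x + h) - f x) <= 2 * (B * nrm h).
Proof.
move=> xr xhr; rewrite -[X in nrm X]subr0.
have seg (t : R) : 0 <= t <= 1 -> nrm (x + (t%:C)%C *: h) <= rho / 2.
  move=> t01.
  have -> : x + (t%:C)%C *: h = ((1 - t)%:C)%C *: x + (t%:C)%C *: (x + h).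
    by rewrite scalerDr addrA -scalerDl -rmorphD /= subrK scale1r.
  rewrite (le_trans (nrmD _ _)) // !nrmZ !nrm_real !ger0_norm; nra.
apply: MVT_bound => t /seg h1.
  by have [] := fP (z := x + (t%:C)%C *: h) ltac:(move: rho0 => ?; lra).
by rewrite subr0; exact: derive_lipschitz.
Qed.

(** [taylor_estimate] at scale [rho / (32 * nrm h)], which is at least 1; 4096 is 4 times 32^2. The
    constant is independent of [b], which is what differentiation under the integral requires. *)
Lemma taylor_uniform b h : nrm b <= rho / 4 -> nrm h <= rho / 32 ->
  nrm (f (b + h) - f b - 'D_h f b) <= 4096 * cauchyC ^+ 2 * M / rho ^+ 2 * nrm h ^+ 2.
Proof.
move=> br hr; have [df _] := fP (z := b) ltac:(move: rho0 => ?; lra).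
have [->|h0] := eqVneq h 0.
  by rewrite addr0 subrr sub0r nrmN deriveE // linear0 !nrm0 expr0n mulr0.
have nh := nrm_gt0 h0.
have -> : 4096 * cauchyC ^+ 2 * M / rho ^+ 2 * nrm h ^+ 2 =
    4 * cauchyC ^+ 2 * M / (rho / (32 * nrm h)) ^+ 2.
  by field; rewrite !gt_eqF.
have H (t : C) : nrm t <= 8 * (rho / (32 * nrm h)) -> nrm (b + t *: h) < rho.
  move=> ts; apply: (le_lt_trans (nrmD _ _)); rewrite nrmZ.
  have : nrm t * nrm h <= 8 * (rho / (32 * nrm h)) * nrm h by rewrite ler_wpM2r ?nrm_ge0.
  have -> : 8 * (rho / (32 * nrm h)) * nrm h = rho / 4 by field; rewrite gt_eqF.
  by move: rho0 => ?; lra.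
apply: taylor_estimate.
- by rewrite ler_pdivlMr ?mulr_gt0 // mul1r; lra.
- by move=> t /H /fP[].
- by move=> t /H /fP[].
Qed.

(** Scale of a Cauchy square in direction [v] that moves points by at most rho / 16, valid also for
    [v] = 0. *)
Let step (v : V) : R := rho / (32 * (nrm v + 1)).

Let step_gt0 v : 0 < step v.
Proof. by rewrite divr_gt0 // mulr_gt0 // ltr_wpDl ?nrm_ge0. Qed.

Let step_scale v (t : C) : nrm t <= 2 * step v -> nrm (t *: v) <= rho / 16.
Proof.
move=> ts; rewrite nrmZ.
have v1 : 0 < nrm v + 1 by rewrite ltr_wpDl ?nrm_ge0.
have : nrm t * nrm v <= 2 * step v * (nrm v + 1).
  by rewrite ler_pM ?nrm_ge0 // lerDl.
have -> : 2 * step v * (nrm v + 1) = rho / 16 by rewrite /step; field; rewrite gt_eqF.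
done.
Qed.

Let dline v a (t : C) : nrm a <= rho / 4 -> nrm t <= 2 * step v ->
  differentiable f (a + t *: v).
Proof.
move=> ar /step_scale tr; suff /fP[] : nrm (a + t *: v) < rho by [].
apply: (le_lt_trans (nrmD _ _)); move: rho0 => ?; lra.
Qed.

Let cline v a : nrm a <= rho / 4 ->
  annulus_cont (fun z => f (a + (((step v)%:C)%C * z) *: v)).
Proof.
move=> ar; apply: (line_annulus_cont (step_gt0 v)) => t ts.
exact/differentiable_continuous/dline.
Qed.

(** The difference of the Cauchy integrals at [a + h] and [a] has an integrand of size O([nrm h]),
    by [holo_lipschitz]. *)
Lemma derive_continuous v a : nrm a < rho / 4 ->
  {for a, continuous (fun z => 'D_v f z : C^o)}.
Proof.
move=> ar; apply/continuous_nrmP => e e0.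
pose K := cauchyC * (2 * B) / step v.
have K0 : 0 <= K by exact: divr_ge0 (mulr_ge0 cauchyC_ge0 (mulr_ge0 (ler0n _ 2) B0)) (ltW (step_gt0 v)).
exists (Num.min (rho / 4 - nrm a) (e / (K + 1))).
  by rewrite lt_min subr_gt0 ar divr_gt0 //; lra.
move=> h; rewrite lt_min => /andP[h1 h2].
have ahr : nrm (a + h) <= rho / 4 by apply: (le_trans (nrmD _ _)); lra.
rewrite (cauchy_directional (step_gt0 v) (fun t => dline (ltac:(exact: ahr) : nrm (a + h) <= rho / 4))).
rewrite (cauchy_directional (step_gt0 v) (fun t => dline (ltW ar))).
have E := sqintB (cline (v := v) ahr) (cline (v := v) (ltW ar)).
rewrite -mulrBr -mulrBr -E.
have H : nrm (kappa^-1 * (((step v)%:C)%C^-1 * sqint (fun z => f (a + h + (((step v)%:C)%C * z) *: v) + -1 * f (a + (((step v)%:C)%C * z) *: v)))) <= cauchyC * (2 * (B * nrm h)) / step v.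
  apply: (nrm_cauchy_le (step_gt0 v) (annulus_contB (cline (v := v) ahr) (cline (v := v) (ltW ar)))) => z z12.
  rewrite mulN1r addrAC.
  have w1 := step_scale (nrm_scaled (step_gt0 v) z12).
  have w2 := nrmD a ((((step v)%:C)%C * z) *: v).
  have w3 := nrmD (a + (((step v)%:C)%C * z) *: v) h.
  by apply: holo_lipschitz; move: rho0 => ?; lra.
apply: (le_trans H).
have -> : cauchyC * (2 * (B * nrm h)) / step v = K * nrm h by rewrite /K; field; rewrite gt_eqF.
rewrite ltr_pdivlMr in h2; last lra.
have := nrm_ge0 h; nra.
Qed.
Section Second.
Variable v : V.
Let s : R := step v.
Let s0 : 0 < s := step_gt0 v.
Let sv (t : C) : nrm t <= 2 * s -> nrm (t *: v) <= rho / 16 := @step_scale v t.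

(** The candidate for the derivative of ['D_v f] at [a] in direction [h], found by differentiating
    Cauchy's integral formally. *)
Let A a (h : V) : C^o := kappa^-1 * ((s%:C)%C^-1 * sqint (fun z => 'D_h f (a + ((s%:C)%C * z) *: v))).

Let cD a h : nrm a < rho / 8 -> annulus_cont (fun z => 'D_h f (a + ((s%:C)%C * z) *: v) : C^o).
Proof.
move=> ar; apply: (@line_annulus_cont _ _ (fun z => 'D_h f z : C^o)) => // t ts.
apply: derive_continuous.
have := sv ts; have := nrmD a (t *: v); move: rho0 => ?; lra.
Qed.

Let A_linear a : nrm a < rho / 8 -> linear (A a).
Proof.
move=> ar k h1 h2; rewrite /A.
have dz (z : C) : 1 <= nrm z <= 2 -> differentiable f (a + ((s%:C)%C * z) *: v).
  by move=> z12; apply: dline; [move: rho0 => ?; lra|exact: nrm_scaled].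
have E : sqint (fun z => 'D_(k *: h1 + h2) f (a + ((s%:C)%C * z) *: v)) =
    sqint (fun z => k * 'D_h1 f (a + ((s%:C)%C * z) *: v) + 'D_h2 f (a + ((s%:C)%C * z) *: v)).
  apply: eq_sqint => z /dz df.
  rewrite (deriveE (k *: h1 + h2) df) (deriveE h1 df) (deriveE h2 df).
  exact: linearP.
have c1 := @cD a h1 ar; have c2 := @cD a h2 ar.
have E' := etrans E (sqintD (annulus_contZ (a := k) c1) c2).
have E'' := etrans E' (congr1 (fun y => y + _) (sqintZ k c1)).
apply: (etrans (congr1 (fun y => kappa^-1 * ((s%:C)%C^-1 * y)) E'')).
have H (p q x y : C) : p * (q * (k * x + y)) = k *: (p * (q * x) : C^o) + p * (q * y).
  by rewrite -[k *: _]/(k * _); ring.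
exact: H.
Qed.

(** The error ['D_v f (a + h) - 'D_v f a - A a h] is the Cauchy integral of Taylor remainders of
    [f], hence O([nrm h ^+ 2]) by [taylor_uniform]. As [A a] is linear and continuous, it is the
    differential. *)
Lemma derive_differentiable_aux a : nrm a < rho / 8 ->
  differentiable (fun z => 'D_v f z : C^o) a /\
  forall h, 'D_h (fun z => 'D_v f z : C^o) a = A a h.
Proof.
move=> ar.
pose L : {linear V -> C^o} := HB.pack (A a) (GRing.isLinear.Build _ _ _ _ (A a) (A_linear ar)).
have LA h : L h = A a h by [].
have LB h : nrm (L h) <= cauchyC * B / s * nrm h.
  have -> : cauchyC * B / s * nrm h = cauchyC * (B * nrm h) / s by ring.
  rewrite LA; apply: (nrm_cauchy_le s0 (cD (h := h) ar)) => z z12.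
  apply: derive_lipschitz.
  have := sv (nrm_scaled s0 z12); have := nrmD a (((s%:C)%C * z) *: v); move: rho0 => ?; lra.
have Lc : continuous L.
  move=> x; apply/continuous_nrmP => e e0.
  have K0 : 0 <= cauchyC * B / s := divr_ge0 (mulr_ge0 cauchyC_ge0 B0) (ltW s0).
  exists (e / (cauchyC * B / s + 1)); first by rewrite divr_gt0 //; lra.
  move=> h; rewrite ltr_pdivlMr; last lra.
  move=> hd; rewrite linearD addrC addrA addNr add0r.
  apply: (le_trans (LB h)); have := nrm_ge0 h; lra.
suff E : (fun z => 'D_v f z : C^o) \o shift a = cst ('D_v f a : C^o) + L +o_ (0 : V) id.
  have dE := diff_unique Lc E.
  have dd : differentiable (fun z => 'D_v f z : C^o) a.
    by apply/diff_locallyP; rewrite dE.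
  by split => // h; rewrite deriveE // dE.
apply/eqaddoP => e e0.
have eE : e = ((complex.Re e)%:C)%C.
  by case: e e0 => x y; rewrite ltcE /= => /andP[/eqP -> _].
have e0' : 0 < complex.Re e by move: e0; rewrite ltcE => /andP[].
pose T := 4096 * cauchyC ^+ 2 * M / rho ^+ 2.
have T0 : 0 <= T by exact: divr_ge0 (mulr_ge0 (mulr_ge0 (ler0n _ 4096) (exprn_ge0 2 cauchyC_ge0)) M0) (exprn_ge0 2 (ltW rho0)).
pose Q := cauchyC * T / s.
have Q0 : 0 <= Q := divr_ge0 (mulr_ge0 cauchyC_ge0 T0) (ltW s0).
apply/(@near_nrm _ V 0 (fun h => `|((fun z => 'D_v f z : C^o) \o shift a - (cst ('D_v f a : C^o) + L)) h| <= e * `|h|)).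
exists (Num.min (rho / 32) (complex.Re e / (Q + 1))).
  by rewrite lt_min !divr_gt0 //; lra.
move=> h; rewrite add0r lt_min => /andP[h1 h2].
suff H : nrm ('D_v f (a + h) - 'D_v f a - L h : C^o) <= Q * nrm h ^+ 2.
  rewrite !nrmE eE -rmorphM lecR.
  have -> : ((fun z => 'D_v f z : C^o) \o shift a - (cst ('D_v f a : C^o) + L)) h =
     'D_v f (h + a) - ('D_v f a + L h) by exact: erefl.
  rewrite opprD addrA (addrC h a).
  apply: (le_trans H); rewrite ltr_pdivlMr in h2; last lra.
  have := nrm_ge0 h; nra.
have ahr : nrm (a + h) <= rho / 4.
  by apply: (le_trans (nrmD _ _)); move: rho0 => ?; lra.
have ar4 : nrm a <= rho / 4 by move: rho0 => ?; lra.
rewrite (cauchy_directional s0 (fun t => dline ahr)).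
rewrite (cauchy_directional s0 (fun t => dline ar4)) LA /A.
have c1 := cline (v := v) ahr; have c2 := cline (v := v) ar4; have c3 := @cD a h ar.
have c12 := annulus_contB c1 c2.
have c123 := annulus_contB c12 c3.
have E1 := sqintB c12 c3; rewrite (sqintB c1 c2) in E1.
rewrite -!mulrBr -E1.
have -> : Q * nrm h ^+ 2 = cauchyC * (T * nrm h ^+ 2) / s by rewrite /Q; ring.
apply: (nrm_cauchy_le s0 c123) => z z12; rewrite !mulN1r.
rewrite (addrAC a h).
apply: taylor_uniform; last exact: ltW.
have := sv (nrm_scaled s0 z12); have := nrmD a (((s%:C)%C * z) *: v); move: rho0 => ?; lra.
Qed.

End Second.

Lemma derive_differentiable v a : nrm a < rho / 8 ->
  differentiable (fun z => 'D_v f z : C^o) a.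
Proof. by move=> /(derive_differentiable_aux v)[]. Qed.

(** [A a h] is the Cauchy integral in direction [v] of ['D_h f], now known to be differentiable;
    Cauchy's formula identifies it with ['D_v] of ['D_h f]. *)
Lemma derive_symmetric v h a : nrm a < rho / 16 ->
  'D_h (fun z => 'D_v f z : C^o) a = 'D_v (fun z => 'D_h f z : C^o) a.
Proof.
move=> ar; have ar8 : nrm a < rho / 8 by move: rho0 => ?; lra.
apply: (etrans ((derive_differentiable_aux v ar8).2 h)); apply: esym.
apply: (@cauchy_directional _ _ (fun z => 'D_h f z : C^o) a v (step v) (step_gt0 v)).
move=> t ts; apply: derive_differentiable; apply: (le_lt_trans (nrmD _ _)).
have := step_scale ts; move: rho0 => ?; lra.
Qed.

End Fixed.
End DerivativeHolomorphic.

(** * Products with the factor w - a *)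

Section DerivativeOfProduct.
Context {K : numFieldType}.

Lemma derive_sub_mul (g : K^o -> K^o) (a : K^o) : differentiable g a ->
  'D_1 (fun w : K^o => (w - a) * g w : K^o) a = g a.
Proof.
move=> dg; pose h : K^o -> K^o := id - cst a.
have h1 : derivable h a 1 by apply: derivableB.
have dg1 : derivable g a 1 by exact: diff_derivable.
have -> : (fun w : K^o => (w - a) * g w : K^o) = h * g by [].
have ha : h a = 0 by exact: subrr.
rewrite (deriveM h1 dg1) ha scale0r add0r.
have d1 : derivable (id : K^o -> K^o) a 1 by exact: derivable_id.
have d2 : derivable (cst a : K^o -> K^o) a 1 by exact: derivable_cst.
rewrite (deriveB d1 d2).
by rewrite derive_id derive_cst subr0 -[LHS]/(_ * _) mulr1.
Qed.

Lemma differentiable_sub_mul (g : K^o -> K^o) (a w : K^o) : differentiable g w ->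
  differentiable (fun w : K^o => (w - a) * g w : K^o) w.
Proof.
by move=> dg; apply: (differentiableM (f := fun w : K^o => w - a : K^o)) dg; exact: differentiableB.
Qed.

End DerivativeOfProduct.

(** * Identity principle *)

Section Identity.
Context {R : realType}.
Local Notation C := R[i].

(* The derivative at a of (w - a) * phi w / w ^ k, a function differentiable   *)
(* also at 0 since phi vanishes there, is phi a / a ^ k; Cauchy's formula on a *)
(* square where w stays larger than 2 |a| then bounds phi a by O(2 ^ - k).     *)
Lemma vanish_spread0 (phi : C^o -> C^o) (sg M eta : R) :
  0 < sg -> 0 < eta -> bounded_holo phi sg M ->
  (forall z, nrm z < eta -> phi z = 0) -> forall a, nrm a < sg / 16 -> phi a = 0.
Proof.
move=> sg0 eta0 phiP phi0 a asg.
have [->|an0] := eqVneq a 0; first by apply: phi0; rewrite nrm0.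
have a0 := nrm_gt0 an0.
pose s := sg / 4; have s0 : 0 < s by rewrite divr_gt0.
have M0 : 0 <= M by have [] := phiP 0 ltac:(by rewrite nrm0); move=> _; apply: le_trans; exact: nrm_ge0.
(* On the contour of scale sg / 4 about [a] one has |w| >= sg / 4 - |a| >= [r3], while |a| < sg / 16
   is at most half of [r3]. *)
pose r3 := 3 * sg / 16; have r30 : 0 < r3 by rewrite /r3; lra.
apply: (@nrm_small_eq0 _ _ _ (2 * cauchyC * M)) => e /exists_half_expn_lt[k ke].
pose psi (w : C^o) : C^o := (w - a) * (phi w / w ^+ k).
have dpsi (w : C^o) : nrm w < sg -> differentiable psi w.
  move=> wsg; have [->|w0] := eqVneq w 0; last first.
    by apply: differentiable_sub_mul; apply: differentiable_divX => //; case: (phiP w wsg).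
  (* At 0 the quotient is harmless: [phi], hence [psi], is identically 0 nearby. *)
  apply/derivable1_diffP; have : derivable (cst 0 : C^o -> C^o) 0 1 by exact: derivable_cst.
  apply: near_eq_derivable.
  apply/near_nrm; exists eta => // h hd; rewrite add0r /psi phi0 //.
  by rewrite mul0r mulr0.
have aw (t : C) : nrm t <= 2 * s -> nrm (a + t) < sg.
  by move=> ts; apply: (le_lt_trans (nrmD _ _)); rewrite /s in ts; lra.
have dline (t : C) : nrm t <= 2 * s -> differentiable psi (a + t *: (1 : C^o)).
  by move=> ts; apply: dpsi; rewrite -[t *: _]/(t * 1) mulr1; exact: aw.
have E : 'D_1 psi a = phi a / a ^+ k.
  apply: derive_sub_mul; apply: differentiable_divX => //.
  by have [] := phiP a ltac:(lra).
have := cauchy_directional s0 dline; rewrite E => E2.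
have B : nrm (phi a / a ^+ k) <= cauchyC * (2 * s * (M * (r3 ^+ k)^-1)) / s.
  rewrite E2; apply: (nrm_cauchy_le s0).
    by apply: (line_annulus_cont s0) => t ts; exact/differentiable_continuous/dline.
  move=> z z12; rewrite -[_ *: _]/(_ * _) mulr1 /psi.
  have h1 := nrm_scaled s0 z12; set t := (s%:C)%C * z in h1 *.
  have h2 : s <= nrm t by rewrite /t nrmM nrm_real gtr0_norm //; nra.
  have -> : a + t - a = t by ring.
  have h3 : r3 <= nrm (a + t).
    have := nrm_sub t (- a); rewrite nrmN opprK addrC (addrC t).
    by move: h2; rewrite /r3 /s; lra.
  rewrite nrmM ler_pM ?nrm_ge0 // nrmM ler_pM ?nrm_ge0 //.
    by have [] := phiP _ (aw t h1).
  rewrite nrmV nrmX lef_pV2 ?posrE ?exprn_gt0 //; last by apply: lt_le_trans h3.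
  by rewrite lerXn2r // ?nnegrE ?nrm_ge0 // ltW.
have -> : phi a = (phi a / a ^+ k) * a ^+ k by rewrite divfK // expf_neq0.
rewrite nrmM nrmX.
have ak : nrm a ^+ k <= ((1 / 2) ^+ k) * r3 ^+ k.
  rewrite -exprMn lerXn2r // ?nnegrE ?nrm_ge0 //; first by rewrite mulr_ge0 // ltW.
  by rewrite /r3; lra.
apply: (le_trans (ler_pM (nrm_ge0 _) (exprn_ge0 _ (nrm_ge0 _)) B ak)).
have -> : cauchyC * (2 * s * (M * (r3 ^+ k)^-1)) / s * ((1 / 2) ^+ k * r3 ^+ k) =
   2 * cauchyC * M * (1 / 2) ^+ k.
  by field; rewrite !gt_eqF ?exprn_gt0.
apply: ler_wpM2l; last exact: ltW.
exact: mulr_ge0 (mulr_ge0 (ler0n _ 2) cauchyC_ge0) M0.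
Qed.

Lemma vanish_spread (phi : C^o -> C^o) (c : C^o) (sg M eta : R) :
  0 < sg -> 0 < eta ->
  (forall z, nrm (z - c) < sg -> differentiable phi z /\ nrm (phi z) <= M) ->
  (forall z, nrm (z - c) < eta -> phi z = 0) ->
  forall z, nrm (z - c) < sg / 16 -> phi z = 0.
Proof.
move=> sg0 eta0 phiP phi0 z zc.
have := @vanish_spread0 (fun t => phi (c + t)) sg M eta sg0 eta0 _ _ (z - c) zc.
rewrite (addrC c) subrK; apply.
  move=> w wsg; have [|d b] := phiP (c + w); first by rewrite addrC addKr.
  split; last exact: b.
  apply: (@differentiable_comp _ _ _ _ (fun t : C^o => c + t) phi); last exact: d.
  by apply: differentiableD; [exact: differentiable_cst|exact: ex_diff].
by move=> w we; apply: phi0; rewrite addrC addKr.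
Qed.

Section GermDomain.
Variable V : normedModType C.

Lemma near_bounded_holo (f : V -> C^o) :
  (\forall z \near (0 : V), differentiable f z) ->
  exists rho M, 0 < rho /\ bounded_holo f rho M.
Proof.
move=> df.
have cf : {for 0, continuous f}.
  by apply: differentiable_continuous; exact: nbhs_singleton df.
have [d d0 Hd] := (continuous_nrmP f 0).1 cf 1 ltr01.
have [d' d'0 Hd'] := (near_nrm _ _).1 df.
exists (Num.min d d'), (nrm (f 0) + 1); split; first by rewrite lt_min d0.
move=> z; rewrite lt_min => /andP[zd zd'].
have h1 := Hd _ zd; have h2 := Hd' _ zd'; rewrite add0r in h1; rewrite add0r in h2.
split => //; rewrite -(subrK (f 0) (f z)); apply: (le_trans (nrmD _ _)).
by rewrite addrC lerD2l.
Qed.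

(** Take [q] near 0 with [g q] nonzero; by continuity of [g], [f] vanishes near [q]. For any other
    point [p] of the ball, restrict [f] to the complex line from [q] to [p] and carry its zeros from
    parameter 0 to 1 by finitely many uses of [vanish_spread]. *)
Lemma germ_domain (f g : V -> C^o) :
  (\forall z \near (0 : V), differentiable f z) ->
  (\forall z \near (0 : V), differentiable g z) ->
  (\forall z \near (0 : V), f z * g z = 0) ->
  ~ (\forall z \near (0 : V), g z = 0) -> \forall z \near (0 : V), f z = 0.
Proof.
move=> /near_bounded_holo[r1 [M [r10 fP]]] /near_bounded_holo[r2 [M' [r20 gP]]].
move=> /near_nrm[r3 r30 fg] ng.
pose rho := Num.min r1 (Num.min r2 r3).
have rho0 : 0 < rho by rewrite !lt_min r10 r20.
have rr (z : V) : nrm z < rho -> [/\ nrm z < r1, nrm z < r2 & nrm z < r3].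
  by rewrite !lt_min => /andP[? /andP[? ?]].
have [q [qr gq]] : exists q : V, nrm q < rho /\ g q != 0.
  apply: contrapT => H; apply: ng; apply/near_nrm; exists rho => // h hr.
  by rewrite add0r; apply/eqP/negP => /negP h0; apply: H; exists h.
apply/near_nrm; exists rho => // p pr; rewrite add0r.
pose phi (t : C^o) : C^o := f (q + t *: (p - q)).
pose m := Num.max (nrm p) (nrm q).
have mr : m < rho by rewrite gt_max pr.
have pm : nrm p <= m by rewrite le_max lexx.
have qm : nrm q <= m by rewrite le_max lexx orbT.
pose n := nrm (p - q) + 1; have n0 : 0 < n by rewrite ltr_wpDl ?nrm_ge0.
(* The segment stays in the ball of radius [m] by convexity, so discs of this common radius about
   its parameters stay in the ball of radius [rho]. *)
pose sg := (rho - m) / n; have sg0 : 0 < sg by rewrite divr_gt0 // subr_gt0.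
have seg (t : R) (z : C^o) : 0 <= t <= 1 -> nrm (z - (t%:C)%C) < sg ->
    nrm (q + z *: (p - q)) < rho.
  move=> t01; rewrite ltr_pdivlMr // => zt.
  have -> : q + z *: (p - q) = ((1 - t)%:C)%C *: q + (t%:C)%C *: p + (z - (t%:C)%C) *: (p - q).
    have e : q + (t%:C)%C *: (p - q) = ((1 - t)%:C)%C *: q + (t%:C)%C *: p.
      by rewrite rmorphB rmorph1 /= scalerBr scalerBl scale1r addrA addrAC.
    rewrite -e -addrA -scalerDl; congr (_ + _ *: _).
    by rewrite addrC subrK.
  have h1 : nrm (((1 - t)%:C)%C *: q) <= (1 - t) * m.
    by rewrite nrmZ nrm_real ger0_norm ?ler_wpM2l //; lra.
  have h2 : nrm ((t%:C)%C *: p) <= t * m.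
    by rewrite nrmZ nrm_real ger0_norm ?ler_wpM2l //; lra.
  have h3 : nrm ((z - (t%:C)%C) *: (p - q)) <= nrm (z - (t%:C)%C) * n.
    by rewrite nrmZ ler_wpM2l ?nrm_ge0 // /n lerDl.
  apply: (le_lt_trans (nrmD _ _)).
  have := nrmD (((1 - t)%:C)%C *: q) ((t%:C)%C *: p); lra.
have phiP (t : R) : 0 <= t <= 1 -> forall z : C^o, nrm (z - (t%:C)%C) < sg ->
    differentiable phi z /\ nrm (phi z) <= M.
  move=> t01 z zt; have [h1 _ _] := rr _ (seg t z t01 zt).
  have [d b] := fP _ h1; split => //; exact: differentiable_line.
have phi_start : exists2 eta : R, 0 < eta & forall z : C^o, nrm (z - (0%:C)%C) < eta -> phi z = 0.
  have [qr1 qr2 qr3] := rr _ qr.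
  have cg : {for q, continuous g}.
    by apply: differentiable_continuous; have [] := gP q qr2.
  have gq0 := nrm_gt0 gq.
  have [d d0 Hd] := (continuous_nrmP g q).1 cg (nrm (g q) / 2) ltac:(lra).
  exists (Num.min (d / n) sg); first by rewrite lt_min divr_gt0.
  move=> z; rewrite lt_min => /andP[]; rewrite {1}subr0 => zd zs.
  have [_ _ h3] := rr _ (seg 0 z ltac:(lra) zs).
  have := fg _ h3; rewrite add0r => /eqP; rewrite mulf_eq0 => /orP[/eqP //|/eqP g0].
  exfalso.
  have := Hd (z *: (p - q)); rewrite g0 sub0r nrmN => H.
  have : nrm (g q) <= nrm (g q) / 2; last lra.
  apply: H; rewrite nrmZ; rewrite ltr_pdivlMr // in zd; apply: le_lt_trans zd.
  by rewrite ler_wpM2l ?nrm_ge0 // /n lerDl.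
(* Half of the radius sg / 16 given by [vanish_spread] is spent on moving the centre; the other half
   is the next disc. *)
pose tau (j : nat) : R := Num.min 1 (j%:R * (sg / 32)).
have tau01 j : 0 <= tau j <= 1.
  by rewrite /tau le_min ler01 /= mulr_ge0 ?(ltW sg0) //= ?ge_min ?lexx //; lra.
have step j : exists2 eta : R, 0 < eta & forall z : C^o, nrm (z - ((tau j)%:C)%C) < eta -> phi z = 0.
  elim: j => [|j [eta eta0 IH]].
    have [eta eta0 H] := phi_start; exists eta => // z; rewrite /tau mul0r.
    by rewrite (min_idPr _) ?ler01 //; exact: H.
  have H := vanish_spread sg0 eta0 (phiP _ (tau01 j)) IH.
  exists (sg / 32); first by rewrite divr_gt0.
  move=> z zt; apply: H.
  have -> : z - ((tau j)%:C)%C = (z - ((tau j.+1)%:C)%C) + ((tau j.+1 - tau j)%:C)%C.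
    by rewrite rmorphB /= addrA subrK.
  apply: (le_lt_trans (nrmD _ _)); rewrite nrm_real.
  have : `|tau j.+1 - tau j| <= sg / 32.
    rewrite /tau -natr1 mulrDl mul1r; move: (j%:R * (sg / 32)) => x.
    have u0 : 0 < sg / 32 by rewrite divr_gt0.
    move: u0; move: (sg / 32) => u u0; rewrite ler_norml.
    by case: (leP 1 x) => ?; case: (leP 1 (x + u)) => ?; apply/andP; split; lra.
  lra.
have [j jP] : exists j : nat, tau j = 1.
  exists (Num.bound (32 / sg)); rewrite /tau; apply/min_idPl.
  have := archi_boundP (x := 32 / sg) ltac:(by rewrite divr_ge0 // ltW).
  rewrite ltr_pdivrMr // => h; lra.
have [eta eta0 H] := step j.
have := H 1; rewrite jP rmorph1 subrr nrm0 => /(_ eta0).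
by rewrite /phi scale1r addrC subrK.
Qed.

End GermDomain.
End Identity.

(** * Local and coordinatewise calculus of directional derivatives *)

Section GenericCalculus.
Context {K : numFieldType}.

Lemma near_eq_differentiable (V W : normedModType K) (f g : V -> W) (a : V) :
  (\forall z \near a, f z = g z) -> differentiable f a -> differentiable g a.
Proof.
move=> fg df; have fga : f a = g a := nbhs_singleton fg.
have [dc E] := (diff_locallyP _ _).1 df.
have E' : g \o shift a = cst (g a) + 'd f a +o_ 0 id.
  apply/eqaddoP => e e0; have /eqaddoP /(_ e e0) H := E.
  have fg' : \forall h \near (0 : V), f (h + a) = g (h + a).
    by move: fg; rewrite (near_shift 0 a) /= subr0.
  near=> h.
  have <- : (f \o shift a - (cst (f a) + 'd f a)) h = (g \o shift a - (cst (g a) + 'd f a)) h.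
    rewrite -[LHS]/(f (h + a) - (f a + 'd f a h)) -[RHS]/(g (h + a) - (g a + 'd f a h)).
    by rewrite fga; congr (_ - _); near: h.
  by near: h.
have dE := diff_unique dc E'.
by apply/diff_locallyP; rewrite dE.
Unshelve. all: by end_near. Qed.

Lemma derive_sum_mul (V : normedModType K) (n : nat) (a b : 'I_n -> V -> K^o) (z h : V) :
  (forall i, differentiable (a i) z) -> (forall i, differentiable (b i) z) ->
  differentiable (fun w => \sum_i a i w * b i w : K^o) z /\
  'D_h (fun w => \sum_i a i w * b i w : K^o) z =
    \sum_i ('D_h (a i) z * b i z + a i z * 'D_h (b i) z).
Proof.
move=> da db.
have dab i : differentiable (a i * b i : V -> K^o) z by exact: differentiableM.
have -> : (fun w => \sum_i a i w * b i w : K^o) = \sum_i (a i * b i : V -> K^o).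
  by apply/funext => w; rewrite fct_sumE.
split; first exact: differentiable_sum.
rewrite derive_sum => [|i]; last exact: diff_derivable.
apply: eq_bigr => i _; rewrite deriveM; [|exact: diff_derivable|exact: diff_derivable].
by rewrite addrC -[_ *: _]/(_ * _) -[_ *: 'D_h (b i) z]/(_ * _) mulrC.
Qed.

(** The second-order regularity that bracket computations use; holomorphic germs have it near 0 by
    [holomorphic_scalar] and [holomorphic_vector]. *)
Definition twice_diff (V W : normedModType K) (f : V -> W) (z : V) : Prop :=
  [/\ differentiable f z, forall v, differentiable (fun w => 'D_v f w) z &
  forall v h, 'D_h (fun w => 'D_v f w) z = 'D_v (fun w => 'D_h f w) z].

Section RowVectors.
Variable (n : nat).
Implicit Types (f : 'rV[K]_n -> K^o) (Y Z : 'rV[K]_n -> 'rV[K]_n).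

Definition unit_row (i : 'I_n) : 'rV[K]_n := delta_mx 0 i.

Definition coordf Y (j : 'I_n) : 'rV[K]_n -> K^o := fun z => Y z 0 j.

Lemma derive_coordinates f z v : differentiable f z ->
  'D_v f z = \sum_i v 0 i * 'D_(unit_row i) f z.
Proof.
move=> df; rewrite deriveE // {1}(row_sum_delta v) linear_sum.
by apply: eq_bigr => i _; rewrite linearZ deriveE.
Qed.

Lemma differentiable_comp_row Y z j : differentiable Y z -> differentiable (coordf Y j) z.
Proof.
move=> dY; apply: (@differentiable_comp _ _ _ _ Y (fun N : 'rV[K]_n => N 0 j : K^o)) => //.
exact: differentiable_coord.
Qed.

Lemma differentiable_row Y z : (forall j, differentiable (coordf Y j) z) -> differentiable Y z.
Proof.
move=> dY.
have -> : Y = \sum_j (fun w => coordf Y j w *: unit_row j).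
  by apply/funext => w; rewrite fct_sumE -row_sum_delta.
apply: differentiable_sum => j; exact: differentiableZl.
Qed.

Lemma derive_comp Y z v j : differentiable Y z -> 'D_v Y z 0 j = 'D_v (coordf Y j) z.
Proof.
move=> dY; have dj := differentiable_comp_row j dY.
pose L : {linear 'rV[K]_n -> K^o} := HB.pack (fun N : 'rV[K]_n => N 0 j : K^o)
  (GRing.isLinear.Build K 'rV[K]_n K^o _ (fun N : 'rV[K]_n => N 0 j : K^o)
     (fun k u w => etrans (mxE _ _ _ _) (congr1 (fun x => x + w 0 j) (mxE _ _ _ _)))).
have Lc : continuous L by exact: coord_continuous.
rewrite (deriveE v dY) (deriveE v dj).
have dL : differentiable L (Y z) by apply: linear_differentiable; exact: Lc.
have E : 'd (L \o Y) z = 'd L (Y z) \o 'd Y z :> (_ -> _) := diff_comp dY dL.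
rewrite -[RHS]/('d (L \o Y) z v) E.
by rewrite -[RHS]/('d L (Y z) ('d Y z v)) (diff_lin _ Lc).
Qed.

End RowVectors.
End GenericCalculus.

(** * Brackets of holomorphic vector fields *)

Section LieDerivative.
Context {R : realType} {n : nat}.
Local Notation K := (complex_complex__canonical__Num_NumField R).
Implicit Types (f : 'rV[K]_n -> K^o) (X Y Z : 'rV[K]_n -> 'rV[K]_n).

Lemma holomorphic_scalar f : holomorphic0 f -> \forall z \near (0 : 'rV[K]_n),
  twice_diff f z.
Proof.
move=> /near_bounded_holo[rho [M [rho0 fP]]].
apply/near_nrm; exists (rho / 16); first by rewrite divr_gt0.
move=> z; rewrite add0r => zr; split.
- by have [] := fP z ltac:(lra).
- by move=> v; apply: (derive_differentiable rho0 fP); lra.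
- by move=> v h; apply: (derive_symmetric rho0 fP).
Qed.

Lemma near_near (T : topologicalType) (a : T) (P : T -> Prop) :
  (\forall z \near a, P z) -> \forall z \near a, \forall w \near z, P w.
Proof. exact: nbhs_interior. Qed.

Lemma holomorphic_comp Z j : holomorphic0 Z -> holomorphic0 (coordf Z j).
Proof. by apply: filterS => z; exact: differentiable_comp_row. Qed.

Lemma holomorphic_vector Z : holomorphic0 Z -> \forall z \near (0 : 'rV[K]_n),
  twice_diff Z z.
Proof.
move=> hZ.
have : \forall z \near (0 : 'rV[K]_n), forall j,
  twice_diff (coordf Z j) z.
  by apply: (@filter_forall _ _ (fun j => twice_diff (coordf Z j)) _ (nbhs_filter (0 : 'rV[K]_n))) => j; apply: holomorphic_scalar; exact: holomorphic_comp.
apply: filterS2 (near_near hZ) => z nZ H.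
have dZ : differentiable Z z := nbhs_singleton nZ.
have E v j : \forall w \near z, 'D_v (coordf Z j) w = coordf (fun w => 'D_v Z w) j w.
  by apply: filterS nZ => w dw; rewrite /coordf derive_comp.
have dD v : differentiable (fun w => 'D_v Z w) z.
  apply: differentiable_row => j; apply: near_eq_differentiable (E v j) _.
  by have [_ + _] := H j; apply.
split; [exact: dZ|exact: dD|] => v h; apply/rowP => j.
have [_ _ S] := H j.
apply: (etrans (derive_comp h j (dD v))); apply: (etrans (esym (near_eq_derive _ (E v j)))).
apply: (etrans (S v h)); apply: (etrans (near_eq_derive _ (E h j))).
exact: (esym (derive_comp v j (dD h))).
Qed.

(** The field Y(Z), so that [Y, Z] is [lieder Y Z - lieder Z Y] pointwise. *)
Definition lieder Y Z : 'rV[K]_n -> 'rV[K]_n := fun z => 'D_(Y z) Z z.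

(** Product rule for Y(Z) = sum_i Y_i d_i Z: the first term differentiates [Y]; in the second the
    direction [Y z] is frozen and symmetry of second derivatives of [Z] regroups the sum. *)
Lemma derive_lieder Y Z : holomorphic0 Y -> holomorphic0 Z ->
  \forall z \near (0 : 'rV[K]_n), differentiable (lieder Y Z) z /\
    forall h, 'D_h (lieder Y Z) z = 'D_('D_h Y z) Z z + 'D_h (fun w => 'D_(Y z) Z w) z.
Proof.
move=> hY hZ.
have HZ : \forall z \near (0 : 'rV[K]_n), forall j,
  twice_diff (coordf Z j) z.
  by apply: (@filter_forall _ _ (fun j => twice_diff (coordf Z j)) _ (nbhs_filter (0 : 'rV[K]_n))) => j; apply: holomorphic_scalar; exact: holomorphic_comp.
have VZ := holomorphic_vector hZ.
near=> z.
have dY : differentiable Y z by near: z; exact: hY.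
have [dZ dDZ _] : twice_diff Z z by near: z; exact: VZ.
have H : forall j,
  twice_diff (coordf Z j) z.
  by near: z; exact: HZ.
have nZ : \forall w \near z, differentiable Z w by near: z; exact: near_near hZ.
have E v j : \forall w \near z, 'D_v (coordf Z j) w = coordf (fun w => 'D_v Z w) j w.
  by apply: filterS nZ => w dw; rewrite /coordf derive_comp.
pose F j (w : 'rV[K]_n) : K^o := \sum_i coordf Y i w * 'D_(unit_row i) (coordf Z j) w.
have EF j : \forall w \near z, F j w = coordf (lieder Y Z) j w.
  apply: filterS nZ => w dw.
  exact: esym (etrans (derive_comp (Y w) j dw) (derive_coordinates (Y w) (differentiable_comp_row j dw))).
have dF h j := @derive_sum_mul _ _ n (coordf Y) (fun i w => 'D_(unit_row i) (coordf Z j) w) z h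
  (fun i => differentiable_comp_row i dY) (fun i => let: And3 _ d _ := H j in d (unit_row i)).
have dL : differentiable (lieder Y Z) z.
  apply: differentiable_row => j; apply: near_eq_differentiable (EF j) _.
  exact: (dF 0 j).1.
split; first exact: dL.
move=> h; apply/rowP => j; have [dZj dDZj S] := H j.
apply: (etrans (derive_comp h j dL)); apply: (etrans (esym (near_eq_derive _ (EF j)))).
apply: (etrans (dF h j).2); rewrite mxE big_split /=.
have e1 : 'D_('D_h Y z) Z z 0 j = \sum_i 'D_h (coordf Y i) z * 'D_(unit_row i) (coordf Z j) z.
  apply: (etrans (derive_comp _ j dZ)); apply: (etrans (derive_coordinates _ dZj)).
  by apply: eq_bigr => i _; rewrite (derive_comp h i dY).
have e2 : 'D_h (fun w => 'D_(Y z) Z w) z 0 j =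
    \sum_i coordf Y i z * 'D_h (fun w => 'D_(unit_row i) (coordf Z j) w) z.
  apply: (etrans (derive_comp _ j (dDZ (Y z)))).
  apply: (etrans (esym (near_eq_derive _ (E (Y z) j)))).
  apply: (etrans (S (Y z) h)); apply: (etrans (derive_coordinates _ (dDZj h))).
  apply: eq_bigr => i _.
  exact: (congr1 (fun x => Y z 0 i * x) (S h (unit_row i))).
exact: esym (congr2 (fun x y => x + y) e1 e2).
Unshelve. all: by end_near. Qed.

Lemma centralizerP X Y : centralizer X Y <-> holomorphic0 Y /\
  \forall z \near (0 : 'rV[K]_n), lieder X Y z = lieder Y X z.
Proof.
split=> -[hY H]; split => //; apply: filterS H => z; rewrite /lie_bracket /lieder.
  by move=> /eqP; rewrite subr_eq0 => /eqP.
by move=> ->; rewrite subrr.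
Qed.

Lemma holomorphic_lieder Y Z : holomorphic0 Y -> holomorphic0 Z -> holomorphic0 (lieder Y Z).
Proof. by move=> hY hZ; apply: filterS (derive_lieder hY hZ) => z []. Qed.

Lemma holomorphic_bracket Y Z : holomorphic0 Y -> holomorphic0 Z -> holomorphic0 (lie_bracket Y Z).
Proof.
move=> hY hZ.
apply: filterS2 (holomorphic_lieder hY hZ) (holomorphic_lieder hZ hY) => z d1 d2.
exact: (differentiableB d1 d2).
Qed.

(** The Jacobi identity, by hand: the relations X(Y) = Y(X) and X(Z) = Z(X) hold near each point, so
    they may be differentiated along [Z] and [Y]. *)
Lemma centralizer_bracket X Y Z : holomorphic0 X ->
  centralizer X Y -> centralizer X Z -> centralizer X (lie_bracket Y Z).
Proof.
move=> hX /centralizerP[hY XY] /centralizerP[hZ XZ].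
apply/centralizerP; split; first exact: holomorphic_bracket.
have nXY := near_near XY; have nXZ := near_near XZ.
have LXY := derive_lieder hX hY; have LXZ := derive_lieder hX hZ.
have LYX := derive_lieder hY hX; have LZX := derive_lieder hZ hX.
have LYZ := derive_lieder hY hZ; have LZY := derive_lieder hZ hY.
have VX := holomorphic_vector hX; have VY := holomorphic_vector hY; have VZ := holomorphic_vector hZ.
apply: filterS (filterI nXY (filterI nXZ (filterI LXY (filterI LXZ (filterI LYX
  (filterI LZX (filterI LYZ (filterI LZY (filterI VX (filterI VY VZ)))))))))).
move=> z [eXY [eXZ [[_ lXY] [[_ lXZ] [[_ lYX] [[_ lZX] [[dYZ lYZ] [[dZY lZY]
  [[dX _ SX] [[dY _ SY] [dZ _ SZ]]]]]]]]]]].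
have A : 'D_(Z z) (lieder X Y) z = 'D_(Z z) (lieder Y X) z by exact: near_eq_derive eXY.
have B : 'D_(Y z) (lieder X Z) z = 'D_(Y z) (lieder Z X) z by exact: near_eq_derive eXZ.
have pXY : 'D_(X z) Y z = 'D_(Y z) X z := nbhs_singleton eXY.
have pXZ : 'D_(X z) Z z = 'D_(Z z) X z := nbhs_singleton eXZ.
have e1 : lieder X (lie_bracket Y Z) z = 'D_(X z) (lieder Y Z) z - 'D_(X z) (lieder Z Y) z.
  have d1 : derivable (lieder Y Z) z (X z) by exact: diff_derivable.
  have d2 : derivable (lieder Z Y) z (X z) by exact: diff_derivable.
  exact: deriveB d1 d2.
have e2 : lieder (lie_bracket Y Z) X z = 'D_('D_(Y z) Z z) X z - 'D_('D_(Z z) Y z) X z.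
  have L (u v : 'rV[K]_n) : 'D_(u - v) X z = 'D_u X z - 'D_v X z.
    by rewrite (deriveE u dX) (deriveE v dX) (deriveE (u - v) dX) linearB.
  exact: L.
have add2 (V : zmodType) (a b c d : V) : a = c -> b = d -> a + b = c + d by move=> -> ->.
(* X(Y(Z)) and Y(X(Z)) agree by [X, Y] = 0 and symmetry for [Z]; then X(Z) becomes Z(X). The second
   derivatives of [X] left here and in [t2] cancel by [SX]. *)
have t1 : 'D_(X z) (lieder Y Z) z = 'D_('D_(Y z) Z z) X z + 'D_(Y z) (fun w => 'D_(Z z) X w) z.
  apply: (etrans (lYZ (X z))); apply: etrans (etrans (esym (lXZ (Y z))) (etrans B (lZX (Y z)))).
  apply: add2; last exact: SZ.
  exact: (congr1 (fun v => 'D_v Z z) pXY).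
have t2 : 'D_(X z) (lieder Z Y) z = 'D_('D_(Z z) Y z) X z + 'D_(Z z) (fun w => 'D_(Y z) X w) z.
  apply: (etrans (lZY (X z))); apply: etrans (etrans (esym (lXY (Z z))) (etrans A (lYX (Z z)))).
  apply: add2; last exact: SY.
  exact: (congr1 (fun v => 'D_v Y z) pXZ).
have H (V : zmodType) (l1 l2 t t' e g p q : V) : l1 = t - t' -> l2 = e - g ->
    t = e + p -> t' = g + q -> q = p -> l1 = l2.
  by move=> -> -> -> -> ->; rewrite opprD addrACA subrr addr0.
exact: H e1 e2 t1 t2 (SX (Y z) (Z z)).
Qed.

End LieDerivative.

(** * Bordered minors over a field *)

Section PointwiseAlgebra.
Variable F : fieldType.

(** Schur complement: a unipotent left factor clears the block [b]. *)
Lemma schur_det (r : nat) (a : 'M[F]_1) (b : 'M[F]_(1, r)) (c : 'M[F]_(r, 1)) (M : 'M[F]_r) :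
  M \in unitmx -> \det (block_mx a b c M : 'M[F]_(1 + r)) = (a - b *m invmx M *m c) 0 0 * \det M.
Proof.
move=> uM.
pose L : 'M[F]_(1 + r) := block_mx 1%:M (- (b *m invmx M)) 0 1%:M.
have dL : \det L = 1 by rewrite det_ublock !det1 mulr1.
rewrite -[LHS]mul1r -dL -det_mulmx mulmx_block !mul1mx !mul0mx !add0r.
rewrite !mulNmx (mulmxKV uM) subrr det_lblock; congr (_ * _).
by rewrite det_mx11.
Qed.

(** For each column [l] the Schur complement of the bordered minor is the [l]-th coordinate of the
    difference of the two sides. *)
Lemma span_of_minors (r n : nat) (z : 'rV[F]_n) (y : 'M[F]_(r, n)) (j : 'I_r -> 'I_n) :
  let M := \matrix_(i, k) y i (j k) in
  M \in unitmx ->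
  (forall l, \det (block_mx (\row_(_ < 1) z 0 l) (\row_k z 0 (j k))
                            (\col_i y i l) M : 'M[F]_(1 + r)) = 0) ->
  z = (\row_k z 0 (j k)) *m invmx M *m y.
Proof.
move=> M uM H; apply/rowP => l.
have := H l; rewrite schur_det // => /eqP; rewrite mulf_eq0 => /orP[/eqP|]; last first.
  by move=> /eqP d0; move: uM; rewrite unitmxE d0 unitr0.
rewrite !mxE => /eqP; rewrite subr_eq0 => /eqP ->.
by apply: eq_bigr => i _; rewrite !mxE.
Qed.

(** Selecting columns is a product with a 0-1 matrix, so the rank is at most [n]. *)
Lemma det_col_selection (s n : nat) (A : 'M[F]_(s, n)) (j : 'I_s -> 'I_n) :
  (n < s)%N -> \det (\matrix_(i, k) A i (j k)) = 0.
Proof.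
move=> ns; apply/eqP/negPn/negP => d0.
pose B : 'M[F]_(n, s) := \matrix_(l, k) (l == j k)%:R.
have E : \matrix_(i, k) A i (j k) = A *m B.
  apply/matrixP => i k; rewrite !mxE (bigD1 (j k)) //= !mxE eqxx mulr1 big1 ?addr0 //.
  by move=> l lj; rewrite !mxE (negbTE lj) mulr0.
have : \rank (\matrix_(i, k) A i (j k)) = s by apply/eqP; rewrite -/(row_free _) row_free_unit unitmxE unitfE.
rewrite E => rE; have := mulmx_max_rank A B; rewrite rE leqNgt ns //.
Qed.

End PointwiseAlgebra.

(** * Differentiability of determinants and adjugates *)

Section HolomorphicDeterminant.
Context {K : numFieldType} {V : normedModType K}.

Lemma differentiable_bigsum (I : Type) (s : seq I) (P : pred I) (f : I -> V -> K^o) (z : V) :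
  (forall i, differentiable (f i) z) ->
  differentiable (fun w => \sum_(i <- s | P i) f i w : K^o) z.
Proof.
move=> df; elim: s => [|i s IH].
  by under eq_fun do rewrite big_nil; exact: differentiable_cst.
under eq_fun do rewrite big_cons; case: (P i) => //.
exact: (differentiableD (df i) IH).
Qed.

Lemma differentiable_bigprod (I : Type) (s : seq I) (P : pred I) (f : I -> V -> K^o) (z : V) :
  (forall i, differentiable (f i) z) ->
  differentiable (fun w => \prod_(i <- s | P i) f i w : K^o) z.
Proof.
move=> df; elim: s => [|i s IH].
  by under eq_fun do rewrite big_nil; exact: differentiable_cst.
under eq_fun do rewrite big_cons; case: (P i) => //.
exact: (differentiableM (df i) IH).
Qed.

Lemma differentiable_det (r : nat) (M : V -> 'M[K]_r) (z : V) :
  (forall i k, differentiable (fun w => M w i k : K^o) z) ->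
  differentiable (fun w => \det (M w) : K^o) z.
Proof.
move=> dM; apply: (@differentiable_bigsum _ _ _ (fun (s : {perm 'I_r}) w => (-1) ^+ s * \prod_i M w i (s i) : K^o)) => s.
have dP := @differentiable_bigprod _ (index_enum 'I_r) predT (fun i w => M w i (s i) : K^o) z (fun i => dM i (s i)).
exact: (differentiableM (differentiable_cst _ _) dP).
Qed.

Lemma differentiable_adj (r : nat) (M : V -> 'M[K]_r) (z : V) (k i : 'I_r) :
  (forall i k, differentiable (fun w => M w i k : K^o) z) ->
  differentiable (fun w => \adj (M w) k i : K^o) z.
Proof.
move=> dM.
have -> : (fun w => \adj (M w) k i : K^o) = (fun w => (-1) ^+ (i + k) * \det (row' i (col' k (M w))) : K^o).
  by apply/funext => w; rewrite mxE /cofactor.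
have dD : differentiable (fun w => \det (row' i (col' k (M w))) : K^o) z.
  apply: differentiable_det => i' k'.
  by under eq_fun do rewrite !mxE; exact: dM.
exact: (differentiableM (differentiable_cst _ _) dD).
Qed.

End HolomorphicDeterminant.

(** * The centralizer as a Lie algebra, its wedge rank and its dimension *)

Section Main.
Context {R : realType} {n : nat}.
Local Notation K := (complex_complex__canonical__Num_NumField R).
Implicit Types (X Y Z : 'rV[K]_n -> 'rV[K]_n).

Lemma centralizer_subalgebra X : holomorphic0 X -> lie_subalgebra (centralizer X).
Proof.
move=> hX; split.
- by move=> Y [].
- have d0 z : differentiable (fun _ : 'rV[K]_n => 0 : 'rV[K]_n) z by exact: differentiable_cst.
  apply/centralizerP; split; first by apply: filterE => z; exact: d0.
  apply: filterS hX => z dX; rewrite /lieder.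
  have -> : 'D_(X z) (fun=> 0) z = (0 : 'rV[K]_n) by exact: derive_cst.
  by rewrite deriveE // linear0.
- move=> a Y Z /centralizerP[hY cY] /centralizerP[hZ cZ].
  have dYZ z : differentiable Y z -> differentiable Z z -> differentiable (fun z => a *: Y z + Z z) z.
    by move=> dY dZ; exact: (differentiableD (differentiableZ a dY) dZ).
  apply/centralizerP; split; first by apply: filterS2 hY hZ => z; exact: dYZ.
  apply: filterS (filterI hX (filterI hY (filterI hZ (filterI cY cZ)))) => z [dX [dY [dZ [eY eZ]]]].
  have l1 : 'D_(X z) (fun z => a *: Y z + Z z) z = a *: 'D_(X z) Y z + 'D_(X z) Z z.
    have d1 : derivable (a *: Y) z (X z) by apply: derivableZ; exact: diff_derivable.
    have d2 : derivable Z z (X z) by exact: diff_derivable.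
    apply: (etrans (deriveD d1 d2)); congr (_ + _).
    by apply: deriveZ; exact: diff_derivable.
  have l2 u v : 'D_(a *: u + v) X z = a *: 'D_u X z + 'D_v X z.
    by rewrite (deriveE u dX) (deriveE v dX) (deriveE (a *: u + v) dX) linearP.
  have h (u u' v v' : 'rV[K]_n) : u = u' -> v = v' -> a *: u + v = a *: u' + v'.
    by move=> -> ->.
  exact: etrans (etrans l1 (h _ _ _ _ eY eZ)) (esym (l2 (Y z) (Z z))).
- by move=> Y Z cY cZ; exact: centralizer_bracket.
Qed.

Lemma wedge_family_le X s : wedge_family X s -> (s <= n)%N.
Proof.
move=> [Y _ nw]; rewrite leqNgt; apply/negP => ns; apply: nw; apply: filterE => z.
apply/ffunP => j; rewrite !ffunE.
rewrite -[RHS](det_col_selection (\matrix_(i, l) Y i z 0 l) j ns); congr (\det _).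
by apply/matrixP => i k; rewrite !mxE.
Qed.

Lemma wedge_family0 X : wedge_family X 0.
Proof.
exists (fun i => fun=> 0) => [[]//|H].
(* The map from the empty type, needed to exhibit a component of the empty wedge; that component is
   an empty determinant, equal to 1. *)
pose j0 : {ffun 'I_0 -> 'I_n} :=
  [ffun i : 'I_0 => let: Ordinal m lt := i in False_rect 'I_n (notF (etrans (esym (ltn0 m)) lt))].
have := nbhs_singleton H => /ffunP /(_ j0).
by rewrite !ffunE det_mx00 => /eqP; rewrite oner_eq0.
Qed.

(** The maximum exists, since 0 qualifies and [n] is an upper bound; hence [get] returns it. *)
Lemma wedge_rankP X : wedge_family X (wedge_rank X) /\
  forall s, wedge_family X s -> (s <= wedge_rank X)%N.
Proof.
rewrite /wedge_rank.
apply: (@getPex _ [set r | wedge_family X r /\ forall s, wedge_family X s -> (s <= r)%N]).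
have ex : exists r, (fun r => `[< wedge_family X r >]) r by exists 0%N; apply/asboolP; exact: wedge_family0.
have bd r : `[< wedge_family X r >] -> (r <= n)%N by move=> /asboolP; exact: wedge_family_le.
case: (ex_maxnP ex bd) => m /asboolP wm mmax; exists m; split => // s ws.
by apply: mmax; apply/asboolP.
Qed.

(** [dimension] picks some length of a basis; invariance of that length comes from the transition
    matrices, whose product is the identity of size [d]. *)
Lemma germ_basis_le (W : set ('rV[K]_n -> 'rV[K]_n)) (d e : nat)
    (Y : 'I_d -> 'rV[K]_n -> 'rV[K]_n) (Y' : 'I_e -> 'rV[K]_n -> 'rV[K]_n) :
  @germ_basis K n W d Y -> @germ_basis K n W e Y' -> (d <= e)%N.
Proof.
move=> [YW Yfree Yspan] [YW' Yfree' Yspan'].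
have [A AP] := choice (fun i => Yspan' (Y i) (YW i)).
have [B BP] := choice (fun k => Yspan (Y' k) (YW' k)).
have E : (\matrix_(i, k) A i k) *m (\matrix_(k, i) B k i) = 1%:M.
  apply/matrixP => i l.
  (* Row [i] of AB - 1 is a linear relation between the germs [Y l], hence zero. *)
  pose c l := ((\matrix_(i, k) A i k) *m (\matrix_(k, i) B k i)) i l - (1%:M : 'M[K]_d) i l.
  suff : c l = 0 by move=> /eqP; rewrite subr_eq0 => /eqP.
  apply: (Yfree c).
  have nB := @filter_forall _ _ (fun k z => Y' k z = \sum_i B k i *: Y i z) _ (nbhs_filter (0 : 'rV[K]_n)) BP.
  apply: filterS2 (AP i) nB => z eA eB.
  rewrite /c; under eq_bigr do rewrite scalerBl.
  rewrite sumrB; apply/eqP; rewrite subr_eq0; apply/eqP.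
  have -> : \sum_(l < d) (1%:M : 'M[K]_d) i l *: Y l z = Y i z.
    rewrite (bigD1 i) //= mxE eqxx scale1r big1 ?addr0 // => l' li.
    by rewrite mxE eq_sym (negbTE li) scale0r.
  rewrite eA; under [RHS]eq_bigr do rewrite eB scaler_sumr.
  rewrite exchange_big /=; apply: eq_bigr => l' _.
  rewrite mxE scaler_suml; apply: eq_bigr => k _.
  by rewrite !mxE scalerA.
by have := mulmx1_min E.
Qed.

Lemma dimension_eq (W : set ('rV[K]_n -> 'rV[K]_n)) d : has_dim W d -> dimension W = d.
Proof.
move=> Wd; have [Y bY] := Wd; rewrite /dimension.
have [Y' bY'] : has_dim W (get [set d | has_dim W d]).
  by apply: (@getPex _ [set d | has_dim W d]); exists d.
apply/eqP; rewrite eqn_leq; apply/andP; split.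
  exact: germ_basis_le bY' bY.
exact: germ_basis_le bY bY'.
Qed.

Lemma derive_sum_scale X r (a : 'I_r -> K) (v : 'I_r -> 'rV[K]_n) z : differentiable X z ->
  'D_(\sum_i a i *: v i) X z = \sum_i a i *: 'D_(v i) X z.
Proof.
move=> dX; rewrite (deriveE _ dX) linear_sum; apply: eq_bigr => i _.
by rewrite linearZ (deriveE _ dX).
Qed.

End Main.

(** * Cramer's rule in the centralizer *)

Section Coefficients.
Context {R : realType} {n r : nat}.
Local Notation K := (complex_complex__canonical__Num_NumField R).
Variables (X : 'rV[K]_n -> 'rV[K]_n) (Y : 'I_r -> 'rV[K]_n -> 'rV[K]_n) (j : 'I_r -> 'I_n).
Hypotheses (hX : holomorphic0 X) (cY : forall i, centralizer X (Y i)).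
Hypothesis rmax : forall s, wedge_family X s -> (s <= r)%N.

Definition minor_mx (z : 'rV[K]_n) : 'M[K]_r := \matrix_(i, k) Y i z 0 (j k).
Definition minor (z : 'rV[K]_n) : K^o := \det (minor_mx z).

Hypothesis minor_neq0 : ~ (\forall z \near (0 : 'rV[K]_n), minor z = 0).

Lemma near_all (I : finType) (P : I -> 'rV[K]_n -> Prop) :
  (forall i, \forall z \near (0 : 'rV[K]_n), P i z) ->
  \forall z \near (0 : 'rV[K]_n), forall i, P i z.
Proof. exact: (@filter_forall _ _ P _ (nbhs_filter (0 : 'rV[K]_n))). Qed.

Lemma near_Y : \forall z \near (0 : 'rV[K]_n), forall i,
  differentiable (Y i) z /\ lieder X (Y i) z = lieder (Y i) X z.
Proof.
apply: near_all => i; have /centralizerP[h1 h2] := cY i.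
exact: filterI h1 h2.
Qed.

Lemma differentiable_minor_mx z i k : (forall i, differentiable (Y i) z) ->
  differentiable (fun w => minor_mx w i k : K^o) z.
Proof.
move=> dY; have -> : (fun w => minor_mx w i k : K^o) = coordf (Y i) (j k).
  by apply/funext => w; rewrite mxE.
exact: differentiable_comp_row.
Qed.

Lemma holomorphic_minor : holomorphic0 minor.
Proof.
apply: filterS near_Y => z dY; apply: differentiable_det => i k.
by apply: differentiable_minor_mx => i'; case: (dY i').
Qed.

Section OneField.
Variable Z : 'rV[K]_n -> 'rV[K]_n.
Hypothesis cZ : centralizer X Z.

(** Dividing by [minor] gives the coefficient of [Y i] in [Z]; the adjugate keeps the numerator
    holomorphic where the minor vanishes. *)
Definition cramer_num (i : 'I_r) (z : 'rV[K]_n) : K^o :=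
  \sum_k coordf Z (j k) z * \adj (minor_mx z) k i.

Lemma holomorphic_cramer_num i : holomorphic0 (cramer_num i).
Proof.
have [hZ _] := cZ; apply: filterS2 hZ near_Y => z dZ dY.
have dA k : differentiable (fun w => \adj (minor_mx w) k i : K^o) z.
  by apply: differentiable_adj => i' k'; apply: differentiable_minor_mx => i''; case: (dY i'').
exact: (@derive_sum_mul _ _ r (fun k => coordf Z (j k)) (fun k w => \adj (minor_mx w) k i) z 0
  (fun k => differentiable_comp_row (j k) dZ) dA).1.
Qed.

(** [Z] together with the [Y i] is a family of r + 1 members of the centralizer, so its wedge is the
    zero germ by maximality, and every minor bordering [minor_mx] vanishes. *)
Lemma cramer_span : \forall z \near (0 : 'rV[K]_n), minor z != 0 ->
  Z z = \sum_i (cramer_num i z / minor z) *: Y i z.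
Proof.
pose G (i : 'I_(1 + r)) := match fintype.split i with inl _ => Z | inr i' => Y i' end.
have nG : \forall z \near (0 : 'rV[K]_n), wedge G z = 0.
  apply: contrapT => nw; have : (r.+1 <= r)%N; last by rewrite ltnn.
  apply: rmax; exists G; last exact: nw.
  by move=> i; rewrite /G; case: (fintype.split (i : 'I_(1 + r))) => i'; [exact: cZ|exact: cY].
apply: filterS nG => z Gz mz.
pose y : 'M[K]_(r, n) := \matrix_(i, l) Y i z 0 l.
have ME : \matrix_(i, k) y i (j k) = minor_mx z.
  by apply/matrixP => i k; rewrite !mxE.
have uM : minor_mx z \in unitmx by rewrite unitmxE unitfE.
have := @span_of_minors K r n (Z z) y j; rewrite /= ME => /(_ uM) H.
rewrite [LHS]H; last first.
  (* Columns [l], [j 0], ..., [j (r-1)]: this component of the wedge is the bordered minor. *)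
  move=> l; pose J : {ffun 'I_(1 + r) -> 'I_n} := [ffun k => match fintype.split k with inl _ => l | inr k' => j k' end].
  have /ffunP /(_ J) := Gz; rewrite !ffunE => <-; congr (\det _).
  apply/matrixP => i k; rewrite /G /J !mxE ffunE.
  by case: (fintype.split i) => i'; rewrite !mxE; case: (fintype.split k) => k'; rewrite !mxE.
rewrite mulmx_sum_row; apply: eq_bigr => i _.
have -> : row i y = Y i z by apply/rowP => l; rewrite !mxE.
congr (_ *: _); rewrite /invmx uM mxE /cramer_num mulr_suml.
by apply: eq_bigr => k _; rewrite !mxE /coordf /minor; ring.
Qed.

(** Deriving Z = sum_i f_i Y_i along X gives X(Z) = sum_i X(f_i) Y_i + sum_i f_i X(Y_i). The last
    sum is sum_i f_i Y_i(X) = Z(X) = X(Z), so sum_i X(f_i) Y_i = 0, and the columns [j] form an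
    invertible matrix. *)
Lemma derive_cramer : \forall z \near (0 : 'rV[K]_n), minor z != 0 ->
  forall i, 'D_(X z) (fun w => cramer_num i w / minor w : K^o) z = 0.
Proof.
have /centralizerP[hZ XZ] := cZ.
have nN := near_all (P := fun i z => differentiable (cramer_num i) z) holomorphic_cramer_num.
apply: filterS (filterI hX (filterI hZ (filterI XZ (filterI near_Y (filterI nN (filterI holomorphic_minor
  (near_near cramer_span))))))) => z [dX [dZ [eZ [YP [dN [dD nspan]]]]]] mz.
pose f i (w : 'rV[K]_n) : K^o := cramer_num i w / minor w.
have df i : differentiable (f i) z.
  exact: (differentiableM (dN i) (differentiableV dD mz)).
have mw : \forall w \near z, minor w != 0.
  have cD : {for z, continuous minor} := differentiable_continuous dD.
  exact: cvgr_neq0 cD mz.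
(* The expansion has to hold on a neighbourhood of [z] in order to be differentiated there. *)
have span : \forall w \near z, Z w = \sum_i f i w *: Y i w.
  by apply: filterS2 mw nspan => w mw' /(_ mw').
have spanz : Z z = \sum_i f i z *: Y i z := nbhs_singleton span.
have E l : \sum_i 'D_(X z) (f i) z * Y i z 0 l = 0.
  have El : \forall w \near z, coordf Z l w = \sum_i f i w * coordf (Y i) l w.
    apply: filterS span => w Ew; rewrite /coordf Ew summxE.
    by apply: eq_bigr => i _; rewrite mxE.
  have dYl i : differentiable (coordf (Y i) l) z.
    by apply: differentiable_comp_row; case: (YP i).
  have e1 := near_eq_derive (X z) El.
  have e2 := (@derive_sum_mul _ _ r f (fun i => coordf (Y i) l) z (X z) df dYl).2.
  (* Z(X) is linear in the value of [Z] at [z], so the coefficients are not differentiated on this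
     side. *)
  have e3 : 'D_(X z) (coordf Z l) z = \sum_i f i z * 'D_(X z) (coordf (Y i) l) z.
    apply: (etrans (esym (derive_comp (X z) l dZ))).
    apply: (etrans (congr1 (fun v : 'rV[K]_n => v 0 l) eZ)).
    apply: (etrans (congr1 (fun u => 'D_u X z 0 l) spanz)).
    apply: (etrans (congr1 (fun v : 'rV[K]_n => v 0 l) (derive_sum_scale (fun i => f i z) (fun i => Y i z) dX))).
    rewrite summxE; apply: eq_bigr => i _; rewrite mxE; have [dYi eYi] := YP i.
    have e4 : 'D_(Y i z) X z 0 l = 'D_(X z) (coordf (Y i) l) z.
      exact: (etrans (congr1 (fun v : 'rV[K]_n => v 0 l) (esym eYi)) (derive_comp (X z) l dYi)).
    exact: (congr1 (fun x => f i z * x) e4).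
  have e5 := etrans (esym e3) (etrans e1 e2).
  rewrite big_split /= in e5.
  have H (a b : K) : b = a + b -> a = 0 by move=> /(congr1 (fun x => x - b)); rewrite subrr addrK.
  exact: H e5.
pose g : 'rV[K]_r := \row_i 'D_(X z) (f i) z.
have gM : g *m minor_mx z = 0.
  apply/rowP => k; rewrite !mxE -[RHS](E (j k)).
  by apply: eq_bigr => i _; rewrite !mxE.
have uM : minor_mx z \in unitmx by rewrite unitmxE unitfE.
have g0 : g = 0 by rewrite -(mulmxK uM g) gM mul0mx.
by move=> i; have := congr1 (fun v : 'rV[K]_r => v 0 i) g0; rewrite !mxE.
Qed.

(** The coefficients are meromorphic first integrals, hence constants [a i]. Each coordinate of
    [Z - sum_i a i Y i], multiplied by the minor, is the zero germ, and [germ_domain] cancels the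
    minor. *)
Lemma centralizer_span : first_integrals X = mer_constants ->
  exists a : 'I_r -> K, \forall z \near (0 : 'rV[K]_n), Z z = \sum_i a i *: Y i z.
Proof.
move=> hM.
have cst i : exists c : K, \forall z \near (0 : 'rV[K]_n),
    minor z != 0 -> cramer_num i z / minor z = c.
  pose F := Meromorphic (holomorphic_cramer_num i) holomorphic_minor minor_neq0.
  have : first_integrals X F by apply: filterS derive_cramer => z H mz; exact: H.
  by rewrite hM.
have [a aP] := choice cst; exists a.
have nA := near_all (P := fun i z => minor z != 0 -> cramer_num i z / minor z = a i) aP.
have [hZ _] := cZ.
pose Dl l (z : 'rV[K]_n) : K^o := coordf Z l z - \sum_i a i * coordf (Y i) l z.
have hDl l : holomorphic0 (Dl l).
  apply: filterS2 hZ near_Y => z dZ YP.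
  have dYl i : differentiable (coordf (Y i) l) z by apply: differentiable_comp_row; case: (YP i).
  have ds := (@derive_sum_mul _ _ r (fun i _ => a i) (fun i => coordf (Y i) l) z 0
    (fun i => differentiable_cst _ _) dYl).1.
  exact: (differentiableB (differentiable_comp_row l dZ) ds).
have zero l : \forall z \near (0 : 'rV[K]_n), Dl l z = 0.
  apply: (germ_domain (hDl l) holomorphic_minor) minor_neq0.
  apply: filterS2 cramer_span nA => z span Az.
  (* Where the minor vanishes the product is trivially 0; elsewhere the expansion with constant
     coefficients applies. *)
  have [->|mz] := eqVneq (minor z) 0; first by rewrite mulr0.
  rewrite /Dl /coordf {1}(span mz) summxE.
  under eq_bigr do rewrite mxE (Az _ mz).
  by rewrite subrr mul0r.
apply: filterS (near_all (P := fun l z => Dl l z = 0) zero) => z Dz.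
apply/rowP => l; have := Dz l; rewrite /Dl /coordf => /eqP; rewrite subr_eq0 => /eqP ->.
by rewrite summxE; apply: eq_bigr => i _; rewrite mxE.
Qed.

End OneField.

(** For independence, a relation near 0 is evaluated at one point where the minor is nonzero. *)
Lemma centralizer_has_dim : first_integrals X = mer_constants ->
  has_dim (centralizer X) r.
Proof.
move=> hM; exists Y; split => // [a aP|Z cZ]; last exact: centralizer_span.
have [z [mz az]] : exists z, minor z != 0 /\ \sum_i a i *: Y i z = 0.
  apply: contrapT => H; apply: minor_neq0; apply: filterS aP => z az.
  by apply/eqP/negPn/negP => mz; apply: H; exists z.
have uM : minor_mx z \in unitmx by rewrite unitmxE unitfE.
have aM : (\row_i a i) *m minor_mx z = 0.
  apply/rowP => k; have := congr1 (fun v : 'rV[K]_n => v 0 (j k)) az.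
  rewrite summxE !mxE => e; rewrite -[RHS]e.
  by apply: eq_bigr => i _; rewrite !mxE.
have a0 : \row_i a i = 0 by rewrite -(mulmxK uM (\row_i a i)) aM mul0mx.
by move=> i; have := congr1 (fun v : 'rV[K]_r => v 0 i) a0; rewrite !mxE.
Qed.

End Coefficients.

(** * Choice of a nonzero minor and conclusion *)

Section Conclusion.
Context {R : realType} {n : nat}.
Local Notation K := (complex_complex__canonical__Num_NumField R).

(** There are finitely many column selections: if every minor vanished near 0, a common
    neighbourhood would kill the whole wedge. *)
Lemma exists_minor r (Y : 'I_r -> 'rV[K]_n -> 'rV[K]_n) :
  ~ (\forall z \near (0 : 'rV[K]_n), wedge Y z = 0) ->
  exists j : 'I_r -> 'I_n, ~ (\forall z \near (0 : 'rV[K]_n), minor Y j z = 0).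
Proof.
move=> nw; apply: contrapT => H; apply: nw.
have H' (J : {ffun 'I_r -> 'I_n}) : \forall z \near (0 : 'rV[K]_n), minor Y J z = 0.
  by apply: contrapT => HJ; apply: H; exists J.
apply: filterS (near_all H') => z Hz.
by apply/ffunP => J; rewrite !ffunE; exact: Hz.
Qed.

End Conclusion.

Theorem proposition4 (R : realType) (n : nat) (hn : (2 <= n)%N)
    (X : 'rV[R[i]]_n -> 'rV[R[i]]_n) (hX : vfield X)
    (hM : first_integrals X = mer_constants) :
  [/\ lie_subalgebra (centralizer X),
      finite_dim (centralizer X) &
      dimension (centralizer X) = wedge_rank X].
Proof.
have [[Y cY nw] rmax] := wedge_rankP X.
have [j mj] := exists_minor nw.
have hd := centralizer_has_dim hX cY rmax mj hM.
split; [exact: centralizer_subalgebra|by exists (wedge_rank X)|exact: dimension_eq].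
Qed.
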